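(* Let $n>1$ and let $\phi_1,\phi_2$ be a pair of co-prime inner functions on $\mathbb{D}^n$. Then the following are equivalent: (i) $[P_{\phi_1},P_{\phi_2}]$ has finite rank; (ii) $\phi_1$ and $\phi_2$ depend on disjoint sets of variables; (iii) $[P_{\phi_1},P_{\phi_2}]=0$.
   Context: $\mathbb{D}^n$ is the open unit polydisc, $\mathbb{T}^n$ its distinguished boundary, $H^2(\mathbb{D}^n)$ the Hardy space of the polydisc. An inner function on $\mathbb{D}^n$ is a bounded analytic function $\phi$ on $\mathbb{D}^n$ with $|\phi|=1$ a.e. on $\mathbb{T}^n$. $P_\phi$ is the orthogonal projection of $H^2(\mathbb{D}^n)$ onto the closed subspace $\phi H^2(\mathbb{D}^n)$, and $[P,Q]=PQ-QP$. For $n>1$, inner functions $\phi_1,\phi_2$ on $\mathbb{D}^n$ are co-prime if $\phi_1H^2(\mathbb{D}^n)\cap\phi_2H^2(\mathbb{D}^n)=\phi_1\phi_2H^2(\mathbb{D}^n)$. The functions $\phi_1,\phi_2$ depend on disjoint sets of variables if there are disjoint subsets $\mathcal{I},\mathcal{J}\subseteq\{z_1,\dots,z_n\}$ such that $\phi_1$ depends only on the variables in $\mathcal{I}$ and $\phi_2$ only on those in $\mathcal{J}$. *)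

(* Defs.v *)
From HB Require Import structures.
From mathcomp Require Import all_boot all_order all_algebra.
From mathcomp Require Import complex.
From mathcomp Require Import finmap all_classical all_reals all_analysis.
From mathcomp.analysis.showcase Require summability.

Set Implicit Arguments.
Unset Strict Implicit.
Unset Printing Implicit Defensive.
Import Order.TTheory GRing.Theory Num.Theory.
Import numFieldNormedType.Exports.
Local Open Scope classical_set_scope.
Local Open Scope ring_scope.
Local Open Scope complex_scope.

(* Packing [R[i]] as a numClosedFieldType is what gives it the topology and
   the norm that MathComp-Analysis attaches to numeric fields. *)
Definition Cx (R : realType) : numClosedFieldType := R[i].

Definition ofR (R : realType) (x : R) : Cx R := x%:C.

Section Torus.
Variable R : realType.

Lemma two_pi_gt0 : (0 : R) < pi *+ 2.
Proof. by rewrite mulrn_wgt0// pi_gt0. Qed.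

Definition angle_cons n (p : measurableTypeR R * n.-tuple (measurableTypeR R)) :
  n.+1.-tuple (measurableTypeR R) := [tuple of p.1 :: p.2].

Lemma measurable_angle_cons n : measurable_fun setT (@angle_cons n).
Proof. by apply: measurable_cons. Qed.

HB.instance Definition _ n :=
  isMeasurableFun.Build _ _ _ _ (@angle_cons n) (@measurable_angle_cons n).

(* Normalized Lebesgue measure on T^n in angular coordinates: the n-fold
   product of the uniform probability on [0, 2 pi]. *)
Fixpoint torus_measure n : probability (n.-tuple (measurableTypeR R)) R :=
  match n with
  | 0 => dirac [tuple]
  | m.+1 => distribution (uniform_prob two_pi_gt0 \x torus_measure m)%E
              (@angle_cons m)
  end.

Definition torus_point n (t : n.-tuple (measurableTypeR R)) : 'rV[Cx R]_n :=
  \row_(i < n) (cos (tnth t i) +i* sin (tnth t i)).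

End Torus.

Section Polydisc.
Variables (R : realType) (n : nat).
Local Notation C := (Cx R).

Definition polydisc : Type :=
  {z : 'rV[C]_n | [forall i, `|z ord0 i| < 1]}.

Definition multiindex : choiceType := {ffun 'I_n -> nat}.

Definition monomial (a : multiindex) (z : 'rV[C]_n) : C :=
  \prod_(i < n) z ord0 i ^+ a i.

(* The series is summed in the unordered sense, along the finite sets of
   multi-indices; for scalar series this is absolute convergence. *)
Definition is_taylor (c : multiindex -> C) (f : polydisc -> C) : Prop :=
  forall z : polydisc,
    summability.partial_sum (fun a => c a * monomial a (val z))
      @ summability.totally --> f z.

(* Analyticity in power-series form: D^n is a complete Reinhardt domain, so a
   single expansion about the origin represents f on all of D^n. *)
Definition analytic (f : polydisc -> C) : Prop := exists c, is_taylor c f.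

Definition taylor (f : polydisc -> C) : multiindex -> C :=
  xget (fun=> 0) [set c | is_taylor c f].

Definition square_summable (c : multiindex -> C) : Prop :=
  summable [set: multiindex] (fun a => (complex.Re (`|c a| ^+ 2))%:E).

Definition H2 : set (polydisc -> C) :=
  [set f | analytic f /\ square_summable (taylor f)].

Definition H2_inner (f g : polydisc -> C) : C :=
  summability.sum (K := C) (R := C) (fun a => taylor f a * (taylor g a)^*).

(* [f] is evaluated at r * zeta, which lies in D^n for zeta in T^n and
   0 <= r < 1; the default value 0 off D^n does not affect the limit. *)
Definition radial_limit (f : polydisc -> C) (zeta : 'rV[C]_n) (l : C) : Prop :=
  (fun r : R => oapp f 0 (insub (ofR r *: zeta) : option polydisc))
    @ 1^'- --> l.

Definition inner_function (phi : polydisc -> C) : Prop :=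
  [/\ analytic phi,
      exists M : R, forall z, `|phi z| <= ofR M
    & {ae torus_measure R n, forall t,
        exists2 l, radial_limit phi (torus_point t) l & `|l| = 1}].

Definition mulH2 (phi : polydisc -> C) : set (polydisc -> C) :=
  [set (fun z => phi z * f z) | f in H2].

Definition coprime_inner (phi1 phi2 : polydisc -> C) : Prop :=
  mulH2 phi1 `&` mulH2 phi2 = mulH2 (fun z => phi1 z * phi2 z).

(* Orthogonal projection of H^2 onto a closed subspace M; only its values on
   H^2 are meaningful. *)
Definition orthoproj (M : set (polydisc -> C)) (f : polydisc -> C) :
    polydisc -> C :=
  xget (fun=> 0)
    [set p | M p /\ forall g, M g -> H2_inner (fun z => f z - p z) g = 0].

Definition P_ (phi : polydisc -> C) := orthoproj (mulH2 phi).

Definition commutator (S T : (polydisc -> C) -> (polydisc -> C))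
    (f : polydisc -> C) : polydisc -> C :=
  fun z => S (T f) z - T (S f) z.

(* The range of T on H^2 lies in a finite-dimensional subspace of H^2. *)
Definition finite_rank (T : (polydisc -> C) -> (polydisc -> C)) : Prop :=
  exists (m : nat) (e : 'I_m -> (polydisc -> C)),
    (forall j, H2 (e j)) /\
    forall f, H2 f -> exists a : 'I_m -> C,
      forall z, T f z = \sum_(j < m) a j * e j z.

Definition zero_operator (T : (polydisc -> C) -> (polydisc -> C)) : Prop :=
  forall f, H2 f -> forall z, T f z = 0.

Definition depends_only_on (I : {set 'I_n}) (f : polydisc -> C) : Prop :=
  forall z w : polydisc,
    (forall i, i \in I -> val z ord0 i = val w ord0 i) -> f z = f w.

Definition disjoint_variables (phi1 phi2 : polydisc -> C) : Prop :=
  exists I J : {set 'I_n},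
    [/\ fintype.disjoint (mem I) (mem J), depends_only_on I phi1
      & depends_only_on J phi2].

End Polydisc.

(* Main.v *)
Require Import Defs.
From mathcomp Require Import all_boot all_order all_algebra.
From mathcomp Require Import all_classical all_reals.
From mathcomp Require Import complex finmap all_analysis.
From mathcomp Require Import measurable_realfun ring lra zify.
From mathcomp.analysis.showcase Require summability.

(* Identify H^2 with the square-summable families of Taylor coefficients.  For r < 1 Parseval's
   formula on the torus of radius r holds for phi times a polynomial; letting r tend to 1 by
   dominated convergence, |phi| = 1 a.e. shows that T_phi is an isometry of H^2, so that
   P_phi = T_phi T_phi^*.

   If phi1 and phi2 depend on disjoint sets of variables then T_phi1^* T_phi2 = T_phi2 T_phi1^*,
   hence the projections commute.

   Conversely let the commutator have finite rank and suppose that both functions depend on z_i.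
   Let M be multiplication by z_i, j <> i, and consider h = p(z_j) M^* phi1 with p a polynomial.
   If deg p is large, p can be chosen so that the commutator kills phi2 h and phi2 M h, and
   coprimeness then gives T_phi1^* T_phi2 f = T_phi2 T_phi1^* f for f = h and f = M h.  With
   u = T_phi1^* M h this reads M^* (phi2 w) = 0 for w = u - M M^* u, i.e. phi2 w does not depend
   on z_i, while w does not either; as phi2 does, w = 0.  But then
   <h, h> = <p(z_j) phi1, M h> = <p(z_j), u> = <p(z_j), M M^* u> = 0, a contradiction. *)

Set Implicit Arguments.
Unset Strict Implicit.
Unset Printing Implicit Defensive.
Import Order.TTheory GRing.Theory Num.Theory.
Import numFieldNormedType.Exports.
Local Open Scope classical_set_scope.
Local Open Scope fset_scope.
Local Open Scope ring_scope.

(* Boundary values enter only for phi times a polynomial, never for a general element of H^2.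
   Polarizing the norm identity for such products makes the functions z^b phi orthonormal, and the
   rest is Hilbert space theory for this orthonormal family. In the converse, p is a polynomial in a
   second variable z_j because multiplication by p(z_j) commutes with M^*, so that h = M^* (p phi1),
   and because its coefficients are free parameters. A commutator whose range is spanned by m
   functions imposes m linear conditions at phi2 h and m at phi2 M h, so 2m + 1 coefficients are
   enough; h is nonzero because phi1 depends on z_i. Both conditions are needed: M^* u = T_phi1^* h,
   and commutation at M h and at h turns M^* (phi2 u) and phi2 M^* u into the same function T_phi1^*
   (phi2 h), whence M^* (phi2 w) = 0. That w vanishes is then the absence of zero divisors among
   power series, applied to w and the z_i-divisible part of phi2. The last pairing is zero because
   M^* p(z_j) = 0. *)
#[local] Existing Instance summability.totally_filter.

(** * Unordered sums and square-summable families *)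

Section UnorderedSums.
Variables (R : realType) (I : choiceType).
Local Notation C := (Cx R).
Implicit Types (x y : I -> C) (F : {fset I}).

(** Convertible with the convergence in [is_taylor], so a Taylor hypothesis at a point can be fed to
    the lemmas below as it is. *)
Definition hassum x (l : C) : Prop :=
  summability.partial_sum x @ summability.totally --> l.

(** The bound is an element of [C]: in the partial order of [C] the case of the empty set gives
    [0 <= M], so [M] is automatically a nonnegative real number. *)
Definition absbounded x : Prop :=
  exists M : C, forall F, \sum_(i <- F) `|x i| <= M.

Lemma partial_sumE x F : summability.partial_sum x F = \sum_(i <- F) x i.
Proof. by rewrite /summability.partial_sum big_seq_fsetE. Qed.

Lemma hassumP x l : hassum x l <->
  forall e : C, 0 < e -> exists F0, forall F, F0 `<=` F ->
    `|l - \sum_(i <- F) x i| < e.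
Proof.
split=> [|h].
  move=> /cvgrPdist_lt h e e0; have [F0 _ hF0] := h e e0.
  by exists F0 => F /hF0 /=; rewrite partial_sumE.
apply/cvgrPdist_lt => e e0; have [F0 hF0] := h e e0; exists F0 => // F /hF0 /=.
by rewrite partial_sumE.
Qed.

Lemma hassum_unique x l l' : hassum x l -> hassum x l' -> l = l'.
Proof. by apply: cvg_unique; exact: norm_hausdorff. Qed.

Lemma hassum_sum x l : hassum x l -> summability.sum (K := C) (R := C) x = l.
Proof. by apply: cvg_lim; exact: norm_hausdorff. Qed.

Lemma eq_hassum x y l : x =1 y -> hassum x l -> hassum y l.
Proof. by move=> /funext ->. Qed.

Lemma hassumD x y l l' : hassum x l -> hassum y l' ->
  hassum (fun i => x i + y i) (l + l').
Proof.
move=> /hassumP hx /hassumP hy; apply/hassumP => e e0.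
have e2 : 0 < e / 2 by rewrite divr_gt0.
have [F0 h0] := hx _ e2; have [F1 h1] := hy _ e2.
exists (F0 `|` F1) => F; rewrite fsubUset => /andP[/h0 {}h0 /h1 {}h1].
rewrite big_split /= opprD addrACA [e]splitr.
by apply: le_lt_trans (ler_normD _ _) _; rewrite ltrD.
Qed.

Lemma hassumZ (k : C) x l : hassum x l -> hassum (fun i => k * x i) (k * l).
Proof.
move=> /hassumP hx; apply/hassumP => e e0.
have k0 : 0 < `|k| + 1 by rewrite ltr_wpDl.
have [|F0 h0] := hx (e / (`|k| + 1)); first by rewrite divr_gt0.
exists F0 => F /h0 {}h0; rewrite -big_distrr /= -mulrBr normrM.
apply: le_lt_trans (_ : (`|k| + 1) * `|l - \sum_(i <- F) x i| < e).
  by rewrite ler_wpM2r// lerDl.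
by rewrite mulrC -ltr_pdivlMr.
Qed.

Arguments hassumZ k {x l}.

Lemma hassum_conj x l : hassum x l -> hassum (fun i => (x i)^*) (l^*).
Proof.
move=> /hassumP h; apply/hassumP => e /h [F0 hF0]; exists F0 => F /hF0.
by rewrite -(norm_conjC (l - _)) rmorphB rmorph_sum.
Qed.

Lemma sum_fset_sub (x : I -> C) F F' : F `<=` F' ->
  \sum_(i <- F') x i = \sum_(i <- F) x i + \sum_(i <- F' `\` F) x i.
Proof.
move=> sub; rewrite (big_fsetID _ (mem F)) /=; congr (_ + _); apply: eq_fbigl.
  by move=> i; rewrite !inE /= andbC; case: (boolP (i \in F)) => //= /(fsubsetP sub) ->.
by move=> i; rewrite !inE /= andbC.
Qed.

Lemma hassum_supp x F0 : (forall i, i \notin F0 -> x i = 0) ->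
  hassum x (\sum_(i <- F0) x i).
Proof.
move=> h; apply/hassumP => e e0; exists F0 => F sub.
rewrite (sum_fset_sub x sub) (_ : \sum_(i <- F `\` F0) x i = 0).
  by rewrite addr0 subrr normr0.
by apply: big1_fset => i; rewrite inE => /andP[/h].
Qed.

Lemma hassum1 x i0 : (forall i, i != i0 -> x i = 0) -> hassum x (x i0).
Proof.
move=> h; rewrite -[x i0](@big_seq_fset1 _ 0 +%R _ i0 x).
by apply: hassum_supp => i; rewrite inE; exact: h.
Qed.

Lemma hassum0 : hassum (fun=> 0) 0.
Proof.
have := @hassum_supp (fun=> 0) fset0 (fun _ _ => erefl).
by rewrite big_seq_fset0.
Qed.

Lemma hassum_norm_le x l M :
  (forall F, `|\sum_(i <- F) x i| <= M) -> hassum x l -> `|l| <= M.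
Proof.
move=> hM /hassumP h.
have M0 : 0 <= M by apply: le_trans (hM fset0).
rewrite real_leNgt ?normr_real ?ger0_real//; apply/negP => lt.
have /h [F0 /(_ F0 (fsubset_refl _))] : 0 < `|l| - M by rewrite subr_gt0.
apply/negP; rewrite -real_leNgt ?realB ?normr_real ?ger0_real//.
rewrite lerBlDr; apply: le_trans (_ : `|l - \sum_(i <- F0) x i| + `|\sum_(i <- F0) x i| <= _).
  by apply: le_trans (ler_normD _ _); rewrite subrK.
by rewrite lerD2l.
Qed.

(** Conjugation fixes the terms, hence the limit by uniqueness. The order of [C] is partial, so a
    comparison with a limit can be negated only once the limit is known to be real. *)
Lemma hassum_real x l : (forall i, x i \is Num.real) -> hassum x l ->
  l \is Num.real.
Proof.
move=> xr hx; apply/CrealP; apply: (hassum_unique _ hx).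
by apply: eq_hassum (hassum_conj hx) => i; apply/CrealP.
Qed.

Lemma ler_sum_fset (x : I -> C) F F' : (forall i, 0 <= x i) -> F `<=` F' ->
  \sum_(i <- F) x i <= \sum_(i <- F') x i.
Proof. by move=> x0 /(sum_fset_sub x) ->; rewrite lerDl sumr_ge0. Qed.

Lemma hassum_ge_sum x l F : (forall i, 0 <= x i) -> hassum x l ->
  \sum_(i <- F) x i <= l.
Proof.
move=> x0 hx; have lr := hassum_real (fun i => ger0_real (x0 i)) hx.
move/hassumP : hx => h.
have sr : \sum_(i <- F) x i \is Num.real by rewrite ger0_real// sumr_ge0.
rewrite real_leNgt//; apply/negP => lt.
have [|F0 /(_ (F0 `|` F) (fsubsetUl _ _))] := h (\sum_(i <- F) x i - l).
  by rewrite subr_gt0.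
apply/negP; rewrite -real_leNgt ?normr_real ?(realB sr lr)//.
rewrite distrC.
have rr : \sum_(i <- F0 `|` F) x i - l \is Num.real.
  by rewrite realB// ger0_real// sumr_ge0.
apply: (le_trans _ (real_ler_norm rr)).
by rewrite lerD2r ler_sum_fset// fsubsetUr.
Qed.

(** Positive elements of [C] are real by the definition of its order; this carries epsilons and
    bounds between [C] and [R]. *)
Lemma gt0_ofR (e : C) : 0 < e -> exists2 r : R, 0 < r & e = ofR r.
Proof.
case: e => a b; rewrite ltcE /= => /andP[/eqP -> a0]; by exists a.
Qed.

Lemma ge0_ofR (e : C) : 0 <= e -> exists2 r : R, 0 <= r & e = ofR r.
Proof.
case: e => a b; rewrite lecE /= => /andP[/eqP -> a0]; by exists a.
Qed.

Lemma ofR_sum (J : Type) (r : seq J) (P : pred J) (y : J -> R) :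
  ofR (\sum_(i <- r | P i) y i) = \sum_(i <- r | P i) ofR (y i).
Proof. exact: rmorph_sum. Qed.

Lemma ler_ofR (a b : R) : (ofR a <= ofR b) = (a <= b).
Proof. exact: lecR. Qed.

Lemma normr_ofR (a : R) : `|ofR a| = ofR `|a|.
Proof. by rewrite /ofR normc_def /= expr0n /= addr0 sqrtr_sqr. Qed.

Lemma ler_Im_norm (z : C) : ofR `|complex.Im z| <= `|z|.
Proof.
case: z => a b; rewrite /ofR normc_def lecR /= -sqrtr_sqr ler_wsqrtr//.
by rewrite lerDr sqr_ge0.
Qed.

Lemma ler_Re_norm (z : C) : ofR `|complex.Re z| <= `|z|.
Proof. exact: normc_ge_Re. Qed.

Lemma hassum_bounded_ge0 (y : I -> R) (M : R) : (forall i, 0 <= y i) ->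
  (forall F, \sum_(i <- F) y i <= M) ->
  exists l : R, hassum (fun i => ofR (y i)) (ofR l).
Proof.
move=> y0 hM; pose E := [set s | exists F, s = \sum_(i <- F) y i].
have supE : has_sup E.
  by split; [exists 0, fset0; rewrite big_seq_fset0 | exists M => _ [F ->]].
exists (sup E); apply/hassumP => _ /gt0_ofR[e e0 ->].
have [_ [F0 ->] h0] := sup_adherent e0 supE.
exists F0 => F sub; rewrite -ofR_sum /ofR -rmorphB -/(ofR _) normr_ofR /ofR ltcR.
have le1 : \sum_(i <- F) y i <= sup E.
  by apply: sup_upper_bound => //; exists F.
have le2 : \sum_(i <- F0) y i <= \sum_(i <- F) y i.
  rewrite -ler_ofR !ofR_sum ler_sum_fset// => i; by rewrite (ler_ofR 0).
by rewrite ger0_norm ?subr_ge0//; lra.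
Qed.

Lemma hassum_abs_real (y : I -> R) (M : R) :
  (forall F, \sum_(i <- F) `|y i| <= M) ->
  exists l : C, hassum (fun i => ofR (y i)) l.
Proof.
move=> hM.
have [|F|l hl] := @hassum_bounded_ge0 (fun i => Num.max (y i) 0) M.
- by move=> i; rewrite le_max lexx orbT.
- by apply: le_trans (hM F); apply: ler_sum => i _; rewrite ge_max ler_norm normr_ge0.
have [|F|l' hl'] := @hassum_bounded_ge0 (fun i => Num.max (- y i) 0) M.
- by move=> i; rewrite le_max lexx orbT.
- apply: le_trans (hM F); apply: ler_sum => i _.
  by rewrite ge_max -normrN ler_norm normr_ge0.
eexists; apply: (eq_hassum _ (hassumD hl (hassumZ (-1) hl'))) => i /=.
rewrite mulN1r /ofR -rmorphB /=; congr (_ %:C)%C.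
have [y0|y0] := leP 0 (y i).
  by rewrite max_r ?oppr_le0// subr0.
by rewrite max_l ?oppr_ge0 ?ltW// sub0r opprK.
Qed.

Lemma absbounded_hassum x : absbounded x -> exists l, hassum x l.
Proof.
move=> [M hM].
have M0 : 0 <= M by have := hM fset0; rewrite big_seq_fset0.
have [m m0 eM] := ge0_ofR M0.
have [|l hl] := @hassum_abs_real (fun i => complex.Re (x i)) m.
  move=> F; rewrite -ler_ofR -eM ofR_sum; apply: le_trans (hM F).
  by apply: ler_sum => i _; exact: normc_ge_Re.
have [|l' hl'] := @hassum_abs_real (fun i => complex.Im (x i)) m.
  move=> F; rewrite -ler_ofR -eM ofR_sum; apply: le_trans (hM F).
  by apply: ler_sum => i _; exact: ler_Im_norm.
eexists; apply: (eq_hassum _ (hassumD hl (hassumZ ('i : C) hl'))) => i.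
by rewrite /ofR [RHS]complexE.
Qed.

(** Off [F0] the terms are split by sign, and each of the two halves contributes at most 2, whence
    the 4. *)
Lemma sum_abs_le4 (y : I -> R) F0 :
  (forall F, [disjoint F & F0] -> `|\sum_(i <- F) y i| <= 2) ->
  forall F, \sum_(i <- F) `|y i| <= \sum_(i <- F0) `|y i| + 4.
Proof.
move=> h F.
apply: (@le_trans _ _ (\sum_(i <- F0 `|` F) `|y i|)).
  rewrite -ler_ofR !ofR_sum; apply: ler_sum_fset; last exact: fsubsetUr.
  by move=> i; rewrite (ler_ofR 0).
have -> : \sum_(i <- F0 `|` F) `|y i| =
   \sum_(i <- F0) `|y i| + \sum_(i <- (F0 `|` F) `\` F0) `|y i|.
  rewrite (big_fsetID _ (mem F0)) /=; congr (_ + _); apply: eq_fbigl.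
    by move=> i; rewrite !inE /=; case: (i \in F0); rewrite ?andbF.
  by move=> i; rewrite !inE /= andbC.
rewrite lerD2l.
set G := _ `\` _.
have dG : [disjoint G & F0] 
  by apply/fdisjointP => i; rewrite !inE => /andP[].
rewrite (big_fsetID _ (fun i => 0 <= y i)) /=.
have sub (P : pred I) : [disjoint [fset i in G | P i] & F0].
  apply: fdisjointWl dG; apply/fsubsetP => i; by rewrite !inE /= => /andP[].
have := h _ (sub (fun i => 0 <= y i)); have := h _ (sub (fun i => ~~ (0 <= y i))).
rewrite !ler_norml => /andP[h1 _] /andP[_ h2].
have -> : \sum_(i <- [fset i in G | 0 <= y i]) `|y i| =
    \sum_(i <- [fset i in G | 0 <= y i]) y i.
  rewrite big_seq [RHS]big_seq; apply: eq_bigr => i.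
  by rewrite !inE /= => /andP[_ /ger0_norm].
have -> : \sum_(i <- [fset i in G | ~~ (0 <= y i)]) `|y i| =
    \sum_(i <- [fset i in G | ~~ (0 <= y i)]) - y i.
  rewrite big_seq [RHS]big_seq; apply: eq_bigr => i.
  by rewrite !inE /= -ltNge => /andP[_ /ltr0_norm].
by rewrite sumrN; lra.
Qed.

(** Unordered convergence of scalars is absolute. A finite set off [F0] is the difference of two
    sets containing [F0], so its sum is bounded by 1 + 1; real and imaginary parts are then treated
    separately. *)
Lemma hassum_absbounded x l : hassum x l -> absbounded x.
Proof.
move=> /hassumP /(_ 1 ltr01)[F0 hF0].
have h F : [disjoint F & F0] -> `|\sum_(i <- F) x i| <= 2.
  move=> dF.
  have -> : \sum_(i <- F) x i =
     (l - \sum_(i <- F0) x i) - (l - \sum_(i <- F0 `|` F) x i).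
    rewrite (sum_fset_sub x (fsubsetUl F0 F)) fsetDUl fsetDv fset0U.
    have -> : F `\` F0 = F by apply/fsetDidPl.
    by ring.
  apply: le_trans (ler_normB _ _) _; apply/ltW.
  by rewrite -[2]/(1 + 1) ltrD// hF0// fsubsetUl.
have e2 : ofR (2 : R) = 2 by exact: rmorph_nat.
have hRe := @sum_abs_le4 (fun i => complex.Re (x i)) F0.
have hIm := @sum_abs_le4 (fun i => complex.Im (x i)) F0.
exists (ofR (\sum_(i <- F0) `|complex.Re (x i)| + 4)
      + ofR (\sum_(i <- F0) `|complex.Im (x i)| + 4)) => F.
apply: le_trans (_ : \sum_(i <- F) (ofR `|complex.Re (x i)| + ofR `|complex.Im (x i)|) <= _).
  apply: ler_sum => i _; rewrite {1}[x i]complexE.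
  have ni : `|'i%C : C| = 1 by rewrite normc_def /= expr0n /= add0r expr1n sqrtr1.
  by apply: le_trans (ler_normD _ _) _; rewrite normrM ni mul1r -!normr_ofR.
rewrite big_split /= -!ofR_sum; apply: lerD; rewrite ler_ofR.
  apply: hRe => G /h; rewrite -ler_ofR e2; apply: le_trans.
  by rewrite -(raddf_sum (@complex.Re R)); exact: ler_Re_norm.
apply: hIm => G /h; rewrite -ler_ofR e2; apply: le_trans.
by rewrite -(raddf_sum (@complex.Im R)); exact: ler_Im_norm.
Qed.

Definition L2 x : Prop :=
  exists M : C, forall F, \sum_(i <- F) `|x i| ^+ 2 <= M.

Definition scl (k : C) x : I -> C := fun i => k * x i.

Definition ip x y : C := summability.sum (K := C) (R := C) (fun i => x i * (y i)^*).

Definition delta (i0 : I) : I -> C := fun i => (i == i0)%:R.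

Lemma L2Z k x : L2 x -> L2 (scl k x).
Proof.
move=> [M hM]; exists (`|k| ^+ 2 * M) => F.
under eq_bigr do rewrite normrM exprMn.
by rewrite -big_distrr ler_wpM2l// exprn_ge0.
Qed.

Lemma sqr_normD_le (z w : C) : `|z + w| ^+ 2 <= 2 * `|z| ^+ 2 + 2 * `|w| ^+ 2.
Proof.
apply: le_trans (_ : (`|z| + `|w|) ^+ 2 <= _).
  by rewrite lerXn2r ?nnegrE ?normr_ge0 ?addr_ge0//; exact: ler_normD.
rewrite -subr_ge0.
have -> : 2 * `|z| ^+ 2 + 2 * `|w| ^+ 2 - (`|z| + `|w|) ^+ 2 = (`|z| - `|w|) ^+ 2 by ring.
by rewrite real_exprn_even_ge0// realB ?normr_real.
Qed.

Lemma L2D x y : L2 x -> L2 y -> L2 (x + y).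
Proof.
move=> [M hM] [N hN]; exists (2 * M + 2 * N) => F.
apply: le_trans (_ : \sum_(i <- F) (2 * `|x i| ^+ 2 + 2 * `|y i| ^+ 2) <= _); last first.
  by rewrite big_split -!big_distrr lerD// ler_wpM2l.
by apply: ler_sum => i _; exact: sqr_normD_le.
Qed.

Lemma L2_0 : L2 0.
Proof. by exists 0 => F; rewrite big1// => i _; rewrite normr0 expr0n. Qed.

Lemma L2N x : L2 x -> L2 (- x).
Proof.
move=> [M hM]; exists M => F; apply: le_trans (hM F).
by apply: ler_sum => i _; rewrite normrN.
Qed.

Lemma L2B x y : L2 x -> L2 y -> L2 (x - y).
Proof. by move=> hx hy; apply: L2D => //; exact: L2N. Qed.

Lemma L2_sum (J : Type) (r : seq J) (P : pred J) (h : J -> I -> C) :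
  (forall j, L2 (h j)) -> L2 (\sum_(j <- r | P j) h j).
Proof. by move=> hh; elim/big_ind: _ => //; [exact: L2_0|exact: L2D]. Qed.

Lemma L2_supp x F0 : (forall i, i \notin F0 -> x i = 0) -> L2 x.
Proof.
move=> h; exists (\sum_(i <- F0) `|x i| ^+ 2) => F.
apply: (@hassum_ge_sum (fun i => `|x i| ^+ 2)) => [i|]; first exact: exprn_ge0.
by apply: hassum_supp => i /h ->; rewrite normr0 expr0n.
Qed.

Lemma L2_delta i0 : L2 (delta i0).
Proof.
by apply: (@L2_supp _ [fset i0]) => i; rewrite inE /delta => /negbTE ->.
Qed.

Lemma ip_absbounded x y : L2 x -> L2 y -> absbounded (fun i => x i * (y i)^*).
Proof.
move=> [M hM] [N hN]; exists (M + N) => F.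
apply: le_trans (_ : \sum_(i <- F) (`|x i| ^+ 2 + `|y i| ^+ 2) <= _); last first.
  by rewrite big_split lerD.
apply: ler_sum => i _; rewrite normrM norm_conjC.
apply: le_trans (_ : 2 * (`|x i| * `|y i|) <= _).
  by rewrite ler_peMl ?mulr_ge0// ler1n.
rewrite -subr_ge0.
have -> : `|x i| ^+ 2 + `|y i| ^+ 2 - 2 * (`|x i| * `|y i|) =
  (`|x i| - `|y i|) ^+ 2 by ring.
by rewrite real_exprn_even_ge0// realB ?normr_real.
Qed.

Lemma hassum_ip x y : L2 x -> L2 y -> hassum (fun i => x i * (y i)^*) (ip x y).
Proof.
move=> hx hy; have [l hl] := absbounded_hassum (ip_absbounded hx hy).
by rewrite /ip (hassum_sum hl).
Qed.

Lemma ipE x y l : hassum (fun i => x i * (y i)^*) l -> ip x y = l.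
Proof. exact: hassum_sum. Qed.

Lemma ipC x y : L2 x -> L2 y -> ip y x = (ip x y)^*.
Proof.
move=> hx hy; apply: ipE; apply: eq_hassum (hassum_conj (hassum_ip hx hy)) => i.
by rewrite rmorphM /= conjCK mulrC.
Qed.

Lemma ipDl x x' y : L2 x -> L2 x' -> L2 y -> ip (x + x') y = ip x y + ip x' y.
Proof.
move=> hx hx' hy; apply: ipE.
apply: eq_hassum (hassumD (hassum_ip hx hy) (hassum_ip hx' hy)) => i.
by rewrite -mulrDl.
Qed.

Lemma ipZl k x y : L2 x -> L2 y -> ip (scl k x) y = k * ip x y.
Proof.
move=> hx hy; apply: ipE.
apply: eq_hassum (hassumZ k (hassum_ip hx hy)) => i.
by rewrite mulrA.
Qed.

Lemma ip0l y : ip 0 y = 0.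
Proof. by apply: ipE; apply: eq_hassum hassum0 => i; rewrite mul0r. Qed.

Lemma sclN1 x : scl (-1) x = - x.
Proof. by apply/funext => i; rewrite /scl mulN1r. Qed.

Lemma ipNl x y : L2 x -> L2 y -> ip (- x) y = - ip x y.
Proof. by move=> hx hy; rewrite -sclN1 ipZl// mulN1r. Qed.

Lemma ipBl x x' y : L2 x -> L2 x' -> L2 y -> ip (x - x') y = ip x y - ip x' y.
Proof. by move=> hx hx' hy; rewrite ipDl ?ipNl//; exact: L2N. Qed.

Lemma ip_suml (J : Type) (r : seq J) (P : pred J) (h : J -> I -> C) y :
  (forall j, L2 (h j)) -> L2 y ->
  ip (\sum_(j <- r | P j) h j) y = \sum_(j <- r | P j) ip (h j) y.
Proof.
move=> hh hy; elim: r => [|j r IH]; first by rewrite !big_nil ip0l.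
rewrite !big_cons; case: (P j) => //; rewrite ipDl ?IH//.
exact: L2_sum.
Qed.

Lemma ipDr x y y' : L2 x -> L2 y -> L2 y' -> ip x (y + y') = ip x y + ip x y'.
Proof.
move=> hx hy hy'; rewrite ipC ?ipDl ?rmorphD //=; last exact: L2D.
by rewrite -!ipC.
Qed.

Lemma ipZr k x y : L2 x -> L2 y -> ip x (scl k y) = k^* * ip x y.
Proof.
move=> hx hy; rewrite ipC ?ipZl ?rmorphM //=; last exact: L2Z.
by rewrite -ipC.
Qed.

Lemma ipBr x y y' : L2 x -> L2 y -> L2 y' -> ip x (y - y') = ip x y - ip x y'.
Proof.
move=> hx hy hy'; rewrite ipC ?ipBl ?rmorphB //=; last exact: L2B.
by rewrite -!ipC.
Qed.

Lemma ip_delta x i : ip x (delta i) = x i.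
Proof.
apply: ipE; have := @hassum1 (fun j => x j * (delta i j)^*) i.
rewrite /delta eqxx rmorph1 mulr1; apply => j /negbTE ->.
by rewrite rmorph0 mulr0.
Qed.

Lemma ip_deltal x i : L2 x -> ip (delta i) x = (x i)^*.
Proof. by move=> hx; rewrite ipC ?ip_delta//; exact: L2_delta. Qed.

Lemma ip_sum_le x F : L2 x -> \sum_(i <- F) `|x i| ^+ 2 <= ip x x.
Proof.
move=> hx; under eq_bigr do rewrite normCK.
apply: (hassum_ge_sum _ _ (hassum_ip hx hx)) => i.
by rewrite -normCK exprn_ge0.
Qed.

Lemma ip_ge0 x : L2 x -> 0 <= ip x x.
Proof. by move=> /(ip_sum_le fset0); rewrite big_seq_fset0. Qed.

Lemma ip_le x M : (forall F, \sum_(i <- F) `|x i| ^+ 2 <= M) -> ip x x <= M.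
Proof.
move=> hM; have hx : L2 x by exists M.
rewrite -(ger0_norm (ip_ge0 hx)).
apply: hassum_norm_le (hassum_ip hx hx) => F.
rewrite ger0_norm; last by apply: sumr_ge0 => i _; rewrite -normCK exprn_ge0.
by under eq_bigr do rewrite -normCK.
Qed.

Lemma ip_eq0 x : L2 x -> ip x x = 0 -> x = 0.
Proof.
move=> hx e; apply/funext => i.
have := ip_sum_le [fset i] hx; rewrite big_seq_fset1 e => h.
by apply/eqP; rewrite -normr_eq0 -sqrf_eq0 eq_le h exprn_ge0.
Qed.

Lemma cauchy_schwarz x y : L2 x -> L2 y ->
  `|ip x y| ^+ 2 <= ip x x * ip y y.
Proof.
move=> hx hy.
have [y0|y0] := eqVneq (ip y y) 0.
  rewrite y0 mulr0 (ip_eq0 hy y0) ipC ?ip0l ?rmorph0 ?normr0 ?expr0n//.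
  exact: L2_0.
have yr : (ip y y)^* = ip y y by rewrite -ipC.
(* Positivity of the norm of [<y,y> x - <x,y> y], the division-free residual of projecting [x] onto
   [y], gives the inequality after cancelling one factor [<y,y>]. *)
have hX := L2Z (ip y y) hx; have hY := L2Z (ip x y) hy.
have := ip_ge0 (L2B hX hY).
rewrite (ipBl hX hY (L2B hX hY)) (ipBr hX hX hY) (ipBr hY hX hY).
rewrite (ipZl _ hx hX) (ipZl _ hx hY) (ipZl _ hy hX) (ipZl _ hy hY).
rewrite (ipZr _ hx hx) (ipZr _ hx hy) (ipZr _ hy hx) (ipZr _ hy hy).
rewrite (ipC hx hy) yr.
set a := ip x x; set b := ip x y; set d := ip y y.
have -> : d * (d * a) - d * (b^* * b) - (b * (d * b^*) - b * (b^* * d)) =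
  d * (a * d - b * b^*) by ring.
have d0 : 0 < d by rewrite lt_def y0 ip_ge0.
by rewrite pmulr_rge0// subr_ge0 normCK.
Qed.

End UnorderedSums.
Arguments hassumZ {R I} k {x l}.

(** * The isometry of an orthonormal family *)

Section Isometry.
Variables (R : realType) (I : choiceType).
Local Notation C := (Cx R).
Implicit Types (x y g h : I -> C) (v : I -> I -> C) (F : {fset I}).

Lemma ip_sumr (J : Type) (r : seq J) (P : pred J) (h : J -> I -> C) y :
  (forall j, L2 (h j)) -> L2 y ->
  ip y (\sum_(j <- r | P j) h j) = \sum_(j <- r | P j) ip y (h j).
Proof.
move=> hh hy; rewrite ipC ?ip_suml ?rmorph_sum //=; last exact: L2_sum.
by apply: eq_bigr => j _; rewrite -ipC.
Qed.

Definition orthofamily v : Prop :=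
  (forall b, L2 (v b)) /\ forall b b', ip (v b) (v b') = (b == b')%:R.

Lemma orthofamily_delta : orthofamily (@delta R I).
Proof.
split=> [b|b b']; first exact: L2_delta.
by rewrite ip_delta /delta eq_sym.
Qed.

Definition comb v (k : I -> C) F : I -> C := \sum_(b <- F) scl (k b) (v b).

Lemma L2_comb v k F : orthofamily v -> L2 (comb v k F).
Proof. by move=> [hv _]; apply: L2_sum => b; exact: L2Z. Qed.

Lemma ip_combr v k F g : orthofamily v -> L2 g ->
  ip g (comb v k F) = \sum_(b <- F) (k b)^* * ip g (v b).
Proof.
move=> [hv _] hg; rewrite ip_sumr//; last by move=> b; exact: L2Z.
by apply: eq_bigr => b _; rewrite ipZr.
Qed.

Lemma ip_combl v k F g : orthofamily v -> L2 g ->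
  ip (comb v k F) g = \sum_(b <- F) k b * ip (v b) g.
Proof.
move=> [hv _] hg; rewrite ip_suml//; last by move=> b; exact: L2Z.
by apply: eq_bigr => b _; rewrite ipZl.
Qed.

Lemma ip_comb_v v k F b : orthofamily v -> b \in F -> ip (comb v k F) (v b) = k b.
Proof.
move=> ov bF; rewrite ip_combl//; last by case: ov.
rewrite (big_fsetD1 b)//= (proj2 ov) eqxx mulr1 big1_fset ?addr0// => b'.
by rewrite !inE (proj2 ov) => /andP[/negbTE -> _]; rewrite mulr0.
Qed.

Lemma ip_comb v k F : orthofamily v ->
  ip (comb v k F) (comb v k F) = \sum_(b <- F) `|k b| ^+ 2.
Proof.
move=> ov; rewrite ip_combr//; last exact: L2_comb.
rewrite big_seq [RHS]big_seq; apply: eq_bigr => b bF.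
by rewrite ip_comb_v// normCK mulrC.
Qed.

(* [Vop v h] is the sum of the [h b] times [v b], computed coordinatewise, and [Vsop v] is
   its adjoint. *)
Definition Vsop v g : I -> C := fun b => ip g (v b).
Definition Vop v h : I -> C := fun a => ip h (Vsop v (delta R a)).

(** Pythagoras for the residual of [g] after projection onto finitely many members of the family;
    Bessel's inequality is its positivity. *)
Lemma ip_sub_comb v g F : orthofamily v -> L2 g ->
  ip (g - comb v (Vsop v g) F) (g - comb v (Vsop v g) F) =
  ip g g - \sum_(b <- F) `|Vsop v g b| ^+ 2.
Proof.
move=> ov hg; have hw := L2_comb (Vsop v g) F ov.
rewrite (ipBl hg hw (L2B hg hw)) (ipBr hg hg hw) (ipBr hw hg hw) ip_comb//.
have e : ip g (comb v (Vsop v g) F) = \sum_(b <- F) `|Vsop v g b| ^+ 2.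
  rewrite ip_combr//; apply: eq_bigr => b _; by rewrite normCK mulrC.
have Sr : \sum_(b <- F) `|Vsop v g b| ^+ 2 \is Num.real.
  by apply/ger0_real/sumr_ge0 => b _; rewrite exprn_ge0.
rewrite (ipC hg hw) e (CrealP Sr).
by rewrite subrr subr0.
Qed.

Lemma bessel v g F : orthofamily v -> L2 g ->
  \sum_(b <- F) `|Vsop v g b| ^+ 2 <= ip g g.
Proof.
move=> ov hg; rewrite -subr_ge0 -ip_sub_comb//; apply: ip_ge0.
by apply: L2B => //; exact: L2_comb.
Qed.

Lemma L2_Vs v g : orthofamily v -> L2 g -> L2 (Vsop v g).
Proof. by move=> ov hg; exists (ip g g) => F; exact: bessel. Qed.

Lemma Vs_le v g : orthofamily v -> L2 g -> ip (Vsop v g) (Vsop v g) <= ip g g.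
Proof. by move=> ov hg; apply: ip_le => F; exact: bessel. Qed.

Lemma VsD v g g' : orthofamily v -> L2 g -> L2 g' ->
  Vsop v (g + g') = Vsop v g + Vsop v g'.
Proof. by move=> [hv _] hg hg'; apply/funext => b; rewrite /Vsop ipDl. Qed.

Lemma VsB v g g' : orthofamily v -> L2 g -> L2 g' ->
  Vsop v (g - g') = Vsop v g - Vsop v g'.
Proof. by move=> [hv _] hg hg'; apply/funext => b; rewrite /Vsop ipBl. Qed.

Lemma VsZ v k g : orthofamily v -> L2 g -> Vsop v (scl k g) = scl k (Vsop v g).
Proof. by move=> [hv _] hg; apply/funext => b; rewrite /Vsop ipZl. Qed.

Lemma Vs_sum v (J : Type) (r : seq J) (P : pred J) (h : J -> I -> C) :
  orthofamily v -> (forall j, L2 (h j)) ->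
  Vsop v (\sum_(j <- r | P j) h j) = \sum_(j <- r | P j) Vsop v (h j).
Proof.
move=> [hv _] hh; apply/funext => b; rewrite /Vsop ip_suml// fct_sumE.
by [].
Qed.

Lemma VopD v g g' : orthofamily v -> L2 g -> L2 g' ->
  Vop v (g + g') = Vop v g + Vop v g'.
Proof.
move=> ov hg hg'; apply/funext => b; rewrite /Vop ipDl//.
by apply: L2_Vs => //; exact: L2_delta.
Qed.

Lemma VopB v g g' : orthofamily v -> L2 g -> L2 g' ->
  Vop v (g - g') = Vop v g - Vop v g'.
Proof.
move=> ov hg hg'; apply/funext => b; rewrite /Vop ipBl//.
by apply: L2_Vs => //; exact: L2_delta.
Qed.

Lemma VopZ v k g : orthofamily v -> L2 g -> Vop v (scl k g) = scl k (Vop v g).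
Proof.
move=> ov hg; apply/funext => b; rewrite /Vop ipZl//.
by apply: L2_Vs => //; exact: L2_delta.
Qed.

Lemma hassum_Vop v h a : orthofamily v -> L2 h ->
  hassum (fun b => h b * v b a) (Vop v h a).
Proof.
move=> ov hh.
have := hassum_ip hh (L2_Vs ov (L2_delta R a)); apply: eq_hassum => b.
by rewrite /Vsop ip_deltal ?conjCK//; case: ov.
Qed.

Lemma ip_Vs_comb v k F h : orthofamily v -> L2 h ->
  ip (Vsop v (comb (@delta R I) k F)) h = \sum_(a <- F) k a * (Vop v h a)^*.
Proof.
move=> ov hh; have dd b := L2Z (k b) (L2_delta R b).
rewrite Vs_sum// ip_suml//; last by move=> b; exact: L2_Vs.
apply: eq_bigr => b _; have hb := L2_Vs ov (L2_delta R b).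
by rewrite VsZ ?ipZl -?ipC//; exact: L2_delta.
Qed.

(** Duality: pairing [h] with [Vsop] of the truncation of [Vop v h] to [F] produces the sum [S]
    itself, and Cauchy-Schwarz with the contractivity of [Vsop] gives [S ^+ 2 <= S * ip h h]. *)
Lemma sum_Vop_le v h F : orthofamily v -> L2 h ->
  \sum_(a <- F) `|Vop v h a| ^+ 2 <= ip h h.
Proof.
move=> ov hh; set S := \sum_(a <- F) _.
have hg := L2_comb (Vop v h) F orthofamily_delta.
have e : ip (Vsop v (comb (@delta R I) (Vop v h) F)) h = S.
  by rewrite ip_Vs_comb//; apply: eq_bigr => a _; rewrite normCK.
have S0 : 0 <= S by apply: sumr_ge0 => a _; rewrite exprn_ge0.
have := cauchy_schwarz (L2_Vs ov hg) hh; rewrite e (ger0_norm S0) => cs.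
have : S ^+ 2 <= S * ip h h.
  apply: le_trans cs _; rewrite ler_wpM2r ?ip_ge0//.
  by apply: le_trans (Vs_le ov hg) _; rewrite ip_comb//; exact: orthofamily_delta.
rewrite expr2; have [->|Sn] := eqVneq S 0; first by rewrite ip_ge0.
by rewrite ler_pM2l// lt_def Sn.
Qed.

Lemma L2_Vop v h : orthofamily v -> L2 h -> L2 (Vop v h).
Proof. by move=> ov hh; exists (ip h h) => F; exact: sum_Vop_le. Qed.

Lemma Vop_le v h : orthofamily v -> L2 h -> ip (Vop v h) (Vop v h) <= ip h h.
Proof. by move=> ov hh; apply: ip_le => F; exact: sum_Vop_le. Qed.

(** For finitely supported [g] this is the definition of [Vop] extended linearly. A general [g] is
    truncated; both pairings are controlled on the remainder because [Vop] and [Vsop] are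
    contractions, so the defect [D] is arbitrarily small. *)
Lemma Vop_adj v g h : orthofamily v -> L2 g -> L2 h ->
  ip g (Vop v h) = ip (Vsop v g) h.
Proof.
move=> ov hg hh; apply/eqP; rewrite -subr_eq0; apply: contraT => Dn.
set D := _ - _ in Dn.
have D0 : 0 < `|D| ^+ 2 by rewrite exprn_gt0// normr_gt0.
have H0 := ip_ge0 hh.
have H1 : 0 < 4 * (ip h h + 1) by rewrite mulr_gt0// ltr_wpDl.
have Vg : Vsop (@delta R I) g = g by apply/funext => a; rewrite /Vsop ip_delta.
(* The truncation error [ip r r] is taken below this value so that the bound of [D] squared by
   [4 * (ip r r * ip h h)] becomes absurd; the summand 1 keeps the divisor positive when [h] is
   zero. *)
have /hassumP/(_ (`|D| ^+ 2 / (4 * (ip h h + 1))))[|F /(_ F (fsubset_refl _))] :=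
    hassum_ip hg hg; first by rewrite divr_gt0.
under eq_bigr do rewrite -normCK.
have hF := L2_comb g F orthofamily_delta.
have hr := L2B hg hF.
have er : ip (g - comb (@delta R I) g F) (g - comb (@delta R I) g F) =
    ip g g - \sum_(a <- F) `|g a| ^+ 2.
  by have := ip_sub_comb F orthofamily_delta hg; rewrite Vg.
rewrite -er ger0_norm ?ip_ge0// => small.
have eD : D = ip (g - comb (@delta R I) g F) (Vop v h) -
             ip (Vsop v (g - comb (@delta R I) g F)) h.
  have hV := L2_Vop ov hh.
  rewrite VsB// (ipBl hg hF hV) (ipBl (L2_Vs ov hg) (L2_Vs ov hF) hh).
  rewrite ip_Vs_comb// ip_combl//; last exact: orthofamily_delta.
  under eq_bigr do rewrite ip_deltal//.
  by rewrite opprB addrA subrK.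
set r := g - _ in hr er small eD.
have ca := cauchy_schwarz hr (L2_Vop ov hh).
have cb := cauchy_schwarz (L2_Vs ov hr) hh.
have {}ca : `|ip r (Vop v h)| ^+ 2 <= ip r r * ip h h.
  by apply: le_trans ca _; rewrite ler_wpM2l ?ip_ge0// Vop_le.
have {}cb : `|ip (Vsop v r) h| ^+ 2 <= ip r r * ip h h.
  by apply: le_trans cb _; rewrite ler_wpM2r ?ip_ge0// Vs_le.
have : `|D| ^+ 2 <= 4 * (ip r r * ip h h).
  set a := ip r (Vop v h) in eD ca; set b := ip (Vsop v r) h in eD cb.
  apply: le_trans (_ : 2 * `|a| ^+ 2 + 2 * `|b| ^+ 2 <= _).
    by rewrite eD -[in leRHS](normrN b); exact: sqr_normD_le.
  have -> : 4 * (ip r r * ip h h) = 2 * (ip r r * ip h h) + 2 * (ip r r * ip h h).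
    by ring.
  by rewrite lerD// ler_wpM2l.
move=> le1; move: small; rewrite ltr_pdivlMr// => small.
have /lt_geF/negbT/negP[] := lt_le_trans small le1.
by rewrite mulrCA ler_wpM2l ?ip_ge0// ler_wpM2l// lerDl.
Qed.

Lemma Vs_v v b : orthofamily v -> Vsop v (v b) = delta R b.
Proof. by move=> [_ on]; apply/funext => b'; rewrite /Vsop on /delta eq_sym. Qed.

Lemma VsVop v h : orthofamily v -> L2 h -> Vsop v (Vop v h) = h.
Proof.
move=> ov hh; apply/funext => b; rewrite /Vsop.
have hb : L2 (v b) by case: ov.
by rewrite ipC ?Vop_adj ?Vs_v ?ip_deltal ?conjCK//; exact: L2_Vop.
Qed.

Lemma ip_Vop v h h' : orthofamily v -> L2 h -> L2 h' ->
  ip (Vop v h) (Vop v h') = ip h h'.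
Proof. by move=> ov hh hh'; rewrite Vop_adj ?VsVop//; exact: L2_Vop. Qed.

Lemma Vop_delta v b : orthofamily v -> Vop v (delta R b) = v b.
Proof.
move=> ov; have hb : L2 (v b) by case: ov.
apply/funext => a; rewrite /Vop ip_deltal; last exact: L2_Vs (L2_delta R a).
by rewrite /Vsop ip_deltal// conjCK.
Qed.

End Isometry.

(** * Integration over the torus *)

Section Trigonometric.
Variable R : realType.
Local Notation C := (Cx R).

Lemma bounded_integrable d (T : measurableType d) (P : probability T R)
    (f : T -> R) (M : R) : measurable_fun [set: T] f ->
  (forall x, `|f x| <= M) -> P.-integrable [set: T] (EFin \o f).
Proof.
move=> mf hM; apply: measurable_bounded_integrable => //.
  by apply: (le_lt_trans (probability_le1 P measurableT)); rewrite ltry.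
exists M; split; first exact: num_real.
by move=> N MN x _ /=; apply: le_trans (hM x) _; exact: ltW.
Qed.

Lemma integral_prob_cst d (T : measurableType d) (P : probability T R) (r : R) :
  (\int[P]_x r%:E = r%:E)%E.
Proof.
rewrite (integral_cst P measurableT r%:E) [X in (_ * X)%E](_ : _ = 1%E) ?mule1//.
exact: probability_setT.
Qed.

Lemma continuous_cosp (p s : R) : continuous (fun x : R => cos (p * x + s)).
Proof.
move=> x.
apply: (@continuous_comp _ _ _ (fun x => p * x + s) cos); last exact: continuous_cos.
apply: (@continuousD _ _ _ (fun x => p * x) (fun=> s)); last exact: cst_continuous.
exact: mulrl_continuous.
Qed.

Lemma measurable_cosp (p s : R) : measurable_fun [set: measurableTypeR R]
  (fun x : measurableTypeR R => cos (p * x + s) : R).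
Proof. exact: (continuous_measurable_fun (@continuous_cosp p s)). Qed.

Lemma sin_shift (p : int) (s : R) : sin (s + p%:~R * (pi *+ 2)) = sin s.
Proof.
rewrite mulrzl; case: p => n; first by rewrite -pmulrn (periodicn (@sinD2pi R)).
by rewrite NegzE mulrNz -pmulrn -(periodicn (@sinD2pi R) n.+1) subrK.
Qed.

Lemma integral_uniform_cos (p : int) (s : R) :
  (\int[uniform_prob (two_pi_gt0 R)]_x (cos (p%:~R * x + s))%:E
     = (if p == 0 then cos s else 0)%:E)%E.
Proof.
have [->|p0] := eqVneq p 0.
  under eq_integral do rewrite mulr0z mul0r add0r.
  exact: integral_prob_cst.
set U := uniform_prob _.
have mc := measurable_cosp p%:~R s.
have ic : U.-integrable setT (EFin \o (fun x => cos (p%:~R * x + s))).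
  by apply: (@bounded_integrable _ _ U _ 1) => // x; rewrite ler_norml cos_geN1 cos_le1.
have i1 : U.-integrable setT (EFin \o (fun=> 1)).
  by apply: (@bounded_integrable _ _ U _ 1) => // x; rewrite normr1.
(* [integral_uniform] asks for a nonnegative integrand, so 1 is added to the cosine and removed at
   the end by linearity. *)
have : (\int[U]_x ((1 + cos (p%:~R * x + s))%:E) = 1)%E.
  rewrite integral_uniform; last 2 first.
  - apply/measurable_EFinP; apply: measurable_funD => //.
  - by move=> x; rewrite lee_fin -lerBlDl sub0r cos_geN1.
  have nz : p%:~R != 0 :> R by rewrite intr_eq0.
  have pi2 := two_pi_gt0 R.
  pose F (x : R) := x + sin (p%:~R * x + s) * (p%:~R)^-1.
  have dF (x : R) : is_derive x 1 F (1 + cos (p%:~R * x + s)).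
    have d1 : is_derive x 1 (fun x : R => p%:~R * x + s) p%:~R.
      apply: is_derive_eq.
      by rewrite addr0 /GRing.scale /= mulr1. 
    have d2 := @is_derive1_comp _ sin (fun x : R => p%:~R * x + s) x _ _
      (is_derive_sin (p%:~R * x + s)) d1.
    apply: is_derive_eq.
    by rewrite /GRing.scale /= mulr0 mulr0 add0r mulrC mulfK.
  have cF : continuous F.
    by move=> x; apply/differentiable_continuous/derivable1_diffP; case: (dF x).
  rewrite (@continuous_FTC2 _ _ F)//.
  - rewrite /F mulr0 !add0r (addrC (_ * _) s) sin_shift subr0 -EFinD -EFinM.
    by congr (_%:E); rewrite addrK mulVf// gt_eqF.
  - have c1 : continuous (fun x : R => 1 + cos (p%:~R * x + s)).
      move=> x; apply: (@continuousD _ _ _ (fun=> 1 : R) (fun x : R => cos (p%:~R * x + s))).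
        exact: cst_continuous.
      exact: continuous_cosp.
    exact: continuous_subspaceT c1.
  - split=> [x _||]; first by case: (dF x).
      exact/cvg_at_right_filter/cF.
    exact/cvg_at_left_filter/cF.
  - by move=> x _; rewrite derive1E; case: (dF x).
rewrite (@integralD_EFin _ _ _ _ _ _ _ _ i1 ic)//.
rewrite (integral_prob_cst U).
case: (\int[U]_x _)%E => //= r; rewrite -EFinD => -[h]; congr (_%:E).
by apply: (addrI 1); rewrite addr0.
Qed.

(** The argument of the monomial with exponents [p] at a torus point. Exponents are integers because
    a monomial times the conjugate of another has exponents of either sign. *)
Definition phase n (p : 'I_n -> int) (t : n.-tuple (measurableTypeR R)) : R :=
  \sum_(i < n) (p i)%:~R * tnth t i.

Lemma measurable_phase n (p : 'I_n -> int) : measurable_fun setT (phase p).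
Proof.
apply: measurable_sum => i; apply: measurable_funM; first exact: measurable_cst.
exact: measurable_tnth.
Qed.

Lemma measurable_cos_phase n (p : 'I_n -> int) s :
  measurable_fun setT (fun t => cos (phase p t + s)).
Proof.
apply: (@measurableT_comp _ _ _ _ _ _ cos).
  exact: continuous_measurable_fun (@continuous_cos R).
by apply: measurable_funD; [exact: measurable_phase|exact: measurable_cst].
Qed.

(* The phase [s] absorbs the first variable, so the induction needs no addition formula. *)
Lemma integral_torus_cos n (p : 'I_n -> int) s :
  (\int[torus_measure R n]_t (cos (phase p t + s))%:E
     = (if [forall i, p i == 0] then cos s else 0)%:E)%E.
Proof.
elim: n p s => [|n IH] p s.
  under eq_integral do rewrite /phase big_ord0 add0r.
  rewrite integral_prob_cst; case: forallP => // -[]; by case.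
have cos1 (x : R) : `|cos x| <= 1 by rewrite ler_norml cos_geN1 cos_le1.
have mc := measurable_cos_phase p s.
have ic : (uniform_prob (two_pi_gt0 R) \x torus_measure R n)%E.-integrable setT
    (EFin \o (fun t => cos (phase p (angle_cons t) + s))).
  apply: (@bounded_integrable _ _ (uniform_prob (two_pi_gt0 R) \x torus_measure R n)%E _ 1) => //.
  exact: measurableT_comp mc (@measurable_angle_cons R n).
rewrite [LHS]integral_distribution; last 2 first.
- exact/measurable_EFinP.
- exact: ic.
rewrite -/(torus_measure R n).
pose q (i : 'I_n) := p (lift ord0 i).
have eq_phase x (t : n.-tuple (measurableTypeR R)) :
    phase p (angle_cons (x, t)) + s = phase q t + ((p ord0)%:~R * x + s).
  rewrite /phase big_ord_recl /= tnth0 [_ * _ + _]addrC -addrA; congr (_ + _).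
  by apply: eq_bigr => i _; rewrite tnthS.
transitivity (\int[uniform_prob (two_pi_gt0 R)]_x
    (if [forall i, q i == 0] then cos ((p ord0)%:~R * x + s) else 0)%:E)%E.
  rewrite -[LHS](integral12_prod_meas1 ic); apply: eq_integral => x _.
  rewrite /fubini_F /=.
  under eq_integral do rewrite eq_phase.
  exact: IH.
have -> : [forall i, p i == 0] = [forall i, q i == 0] && (p ord0 == 0).
  apply/forallP/andP => [h|[/forallP h1 h0] i]; first by split=> //; apply/forallP => i; exact: h.
  by have [j ->|->] := unliftP ord0 i => //; exact: h1.
case: forallP => _; last exact: integral_prob_cst.
exact: integral_uniform_cos.
Qed.

End Trigonometric.

(** * Parseval's formula for trigonometric polynomials *)

Section Parseval.
Variable R : realType.
Local Notation C := (Cx R).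

Definition bdmeas d (T : measurableType d) (f : T -> R) : Prop :=
  measurable_fun [set: T] f /\ exists M, forall x, `|f x| <= M.

Section BoundedMeasurable.
Context d (T : measurableType d) (P : probability T R).
Implicit Types f g : T -> R.

Lemma bdmeas_integrable f : bdmeas f -> P.-integrable [set: T] (EFin \o f).
Proof. by move=> [mf [M hM]]; exact: (bounded_integrable P mf hM). Qed.

Lemma bdmeas_cst (c : R) : bdmeas (fun _ : T => c).
Proof. by split; [exact: measurable_cst|exists `|c|]. Qed.

Lemma bdmeasD f g : bdmeas f -> bdmeas g -> bdmeas (fun x => f x + g x).
Proof.
move=> [mf [M hM]] [mg [N hN]]; split; first exact: measurable_funD.
by exists (M + N) => x; rewrite (le_trans (ler_normD _ _))// lerD.
Qed.

Lemma bdmeasM f g : bdmeas f -> bdmeas g -> bdmeas (fun x => f x * g x).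
Proof.
move=> [mf [M hM]] [mg [N hN]]; split; first exact: measurable_funM.
by exists (M * N) => x; rewrite normrM ler_pM.
Qed.

Lemma bdmeas_sum (J : Type) (r : seq J) (f : J -> T -> R) :
  (forall j, bdmeas (f j)) -> bdmeas (fun x => \sum_(j <- r) f j x).
Proof.
move=> hf; elim: r => [|j r IH].
  by under eq_fun do rewrite big_nil; exact: bdmeas_cst.
by under eq_fun do rewrite big_cons; exact: bdmeasD.
Qed.

Lemma Rintegral_prob_cst (c : R) : \int[P]_x c = c.
Proof. by rewrite /Rintegral integral_prob_cst. Qed.

Lemma EFin_Rintegral f : bdmeas f ->
  (\int[P]_x (f x)%:E)%E = (\int[P]_x f x)%:E.
Proof.
move=> bf; rewrite /Rintegral fineK//.
exact: (integrable_fin_num measurableT (bdmeas_integrable bf)).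
Qed.

Lemma Rintegral_sum (J : Type) (r : seq J) (f : J -> T -> R) :
  (forall j, bdmeas (f j)) ->
  \int[P]_x (\sum_(j <- r) f j x) = \sum_(j <- r) \int[P]_x f j x.
Proof.
move=> hf; elim: r => [|j r IH].
  rewrite big_nil; under eq_Rintegral do rewrite big_nil.
  exact: Rintegral_prob_cst.
under eq_Rintegral do rewrite big_cons.
rewrite RintegralD ?big_cons ?IH//; apply: bdmeas_integrable => //.
exact: bdmeas_sum.
Qed.

End BoundedMeasurable.

(** The squared modulus as an element of [R], since the integrals are those of real-valued
    functions. *)
Definition nsq (z : C) : R := complex.Re z ^+ 2 + complex.Im z ^+ 2.

Lemma normsq_nsq (z : C) : `|z| ^+ 2 = ofR (nsq z).
Proof.
case: z => a b; rewrite /nsq /ofR normc_def -rmorphXn /= sqr_sqrtr//.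
by rewrite addr_ge0 ?sqr_ge0.
Qed.

Lemma nsq_ge0 (z : C) : 0 <= nsq z.
Proof. by rewrite addr_ge0 ?sqr_ge0. Qed.

Lemma ofR_inj : injective (@ofR R).
Proof. by move=> a b []. Qed.

Lemma nsqM (z w : C) : nsq (z * w) = nsq z * nsq w.
Proof.
by apply: ofR_inj; rewrite -normsq_nsq normrM exprMn !normsq_nsq /ofR rmorphM.
Qed.

Definition cis (x : R) : C := Complex (cos x) (sin x).

Lemma cisD (x y : R) : cis (x + y) = cis x * cis y.
Proof. by rewrite /cis cosD sinD; congr Complex; rewrite addrC. Qed.

Lemma cisN (x : R) : cis (- x) = (cis x)^*.
Proof. by rewrite /cis cosN sinN. Qed.

Lemma cis0 : cis 0 = 1.
Proof. by rewrite /cis cos0 sin0. Qed.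

Lemma norm_cis x : `|cis x| = 1.
Proof. by rewrite normc_def /= cos2Dsin2 sqrtr1. Qed.

Variable n : nat.
Local Notation MI := (multiindex n).
Local Notation T := (n.-tuple (measurableTypeR R)).
Local Notation mu := (torus_measure R n).

Lemma monomial_torus (a : MI) (t : T) :
  monomial a (torus_point t) = cis (phase (fun i => (a i)%:Z) t).
Proof.
rewrite /monomial /phase.
rewrite (big_morph cis cisD cis0); apply: eq_bigr => i _.
rewrite mxE -/(cis (tnth t i)).
elim: (a i) => [|k IH]; first by rewrite expr0 mul0r cis0.
by rewrite exprS IH -cisD intS intrD mulrDl mul1r.
Qed.

Lemma monomial_torus_conj (a b : MI) (t : T) :
  monomial a (torus_point t) * (monomial b (torus_point t))^* =
  cis (phase (fun i => (a i)%:Z - (b i)%:Z) t).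
Proof.
rewrite !monomial_torus -cisN -cisD; congr cis.
rewrite /phase -sumrN -big_split; apply: eq_bigr => i _.
by rewrite /= intrD mulrDl mulrNz mulNr.
Qed.

Definition trig (F : {fset MI}) (d : MI -> C) (t : T) : C :=
  \sum_(a <- F) d a * monomial a (torus_point t).

(** The real part of [k e^(i theta)] is [Re k cos theta - Im k sin theta], and [- sin theta] is the
    cosine of [theta + pi / 2]. The summands 0 and [pi / 2] put both terms in the form that
    [integral_torus_cos] computes. *)
Lemma nsq_trig F d t : nsq (trig F d t) =
  \sum_(a <- F) \sum_(b <- F)
    (complex.Re (d a * (d b)^*) * cos (phase (fun i => (a i)%:Z - (b i)%:Z) t + 0)
     + complex.Im (d a * (d b)^*) *
         cos (phase (fun i => (a i)%:Z - (b i)%:Z) t + pi / 2)).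
Proof.
have -> : nsq (trig F d t) = complex.Re (trig F d t * (trig F d t)^*).
  by rewrite -normCK normsq_nsq.
rewrite /trig rmorph_sum /= mulr_suml raddf_sum /=; apply: eq_bigr => a _.
rewrite mulr_sumr raddf_sum /=; apply: eq_bigr => b _.
rewrite rmorphM /= mulrACA monomial_torus_conj addr0 cosDpihalf.
by case: (d a * _) => u v /=; rewrite mulrN.
Qed.

Lemma bdmeas_cos_phase (p : 'I_n -> int) s : bdmeas (fun t : T => cos (phase p t + s)).
Proof.
split; first exact: measurable_cos_phase.
by exists 1 => t; rewrite ler_norml cos_geN1 cos_le1.
Qed.

Lemma bdmeas_nsq_trig F d : bdmeas (fun t => nsq (trig F d t)).
Proof.
under eq_fun do rewrite nsq_trig.
apply: bdmeas_sum => a; apply: bdmeas_sum => b.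
by apply: bdmeasD; apply: bdmeasM; (exact: bdmeas_cst || exact: bdmeas_cos_phase).
Qed.

Lemma integral_nsq_trig F d :
  \int[mu]_t nsq (trig F d t) = \sum_(a <- F) nsq (d a).
Proof.
under eq_Rintegral do rewrite nsq_trig.
have b1 (a b : MI) (c s : R) :
  bdmeas (fun t : T => c * cos (phase (fun i => (a i)%:Z - (b i)%:Z) t + s)).
  by apply: bdmeasM; [exact: bdmeas_cst|exact: bdmeas_cos_phase].
have i1 (a b : MI) (c s : R) :
  \int[mu]_t (c * cos (phase (fun i => (a i)%:Z - (b i)%:Z) t + s)) =
     if a == b then c * cos s else 0.
  rewrite RintegralZl//; last exact/bdmeas_integrable/bdmeas_cos_phase.
  rewrite /Rintegral integral_torus_cos /=.
  have -> : [forall i, (a i)%:Z - (b i)%:Z == 0] = (a == b).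
    apply/forallP/eqP => [h|-> i]; last by rewrite subrr.
    by apply/ffunP => i; have := h i; rewrite subr_eq0 => /eqP[].
  by case: eqP => _; rewrite ?mulr0.
rewrite Rintegral_sum; last by move=> a; apply: bdmeas_sum => b; exact: bdmeasD.
rewrite big_seq [RHS]big_seq; apply: eq_bigr => a aF.
rewrite Rintegral_sum; last by move=> b; exact: bdmeasD.
rewrite (big_fsetD1 a)//= big1_fset => [|b].
  rewrite addr0 RintegralD//; try exact/bdmeas_integrable.
  rewrite !i1 eqxx cos0 mulr1 cos_pihalf mulr0 addr0 -normCK normsq_nsq.
  by [].
rewrite !inE => /andP[ba _] _; rewrite RintegralD//; try exact/bdmeas_integrable.
by rewrite !i1 eq_sym (negbTE ba) addr0.
Qed.

End Parseval.

(** * Parseval's formula on the tori of radius less than one *)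

Section RadialParseval.
Variable R : realType.
Local Notation C := (Cx R).

Lemma bounded_convergence d (T : measurableType d) (P : probability T R)
    (f_ : nat -> T -> R) (f : T -> R) (M : R) :
  (forall k, measurable_fun [set: T] (f_ k)) -> bdmeas f ->
  {ae P, forall x, f_ ^~ x @ \oo --> f x} ->
  (forall k x, `|f_ k x| <= M) ->
  (\int[P]_x f_ k x) @[k --> \oo] --> \int[P]_x f x.
Proof.
move=> mf_ bf cv hM.
have bf_ k : bdmeas (f_ k) by split=> //; exists M.
have [] := @dominated_convergence _ _ _ P setT measurableT
  (fun k x => (f_ k x)%:E) (fun x => (f x)%:E) (fun=> M%:E).
- by move=> k; exact/measurable_EFinP.
- by apply/measurable_EFinP; case: bf.
- apply: filterS cv => x cx _; apply/fine_cvgP; split=> //=.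
  exact: nearW.
- exact/bdmeas_integrable/bdmeas_cst.
- by apply: aeW => x k _ /=; rewrite lee_fin.
move=> _ _; rewrite EFin_Rintegral//.
under eq_fun do rewrite EFin_Rintegral//.
by move=> /fine_cvgP[].
Qed.

Lemma cvg_nsq (J : Type) (F : set_system J) (FF : Filter F) (u : J -> C) (l : C) :
  u @ F --> l -> (fun j => nsq (u j)) @ F --> nsq l.
Proof.
move=> /cvgrPdist_lt h.
have ltr_ofR (a b : R) : (ofR a < ofR b) = (a < b) by exact: ltcR.
have hRe : (fun j => complex.Re (u j)) @ F --> complex.Re l.
  apply/cvgrPdist_lt => e e0; have e0' : 0 < ofR e by rewrite (ltr_ofR 0).
  apply: filterS (h _ e0') => j hj.
  by rewrite -ltr_ofR; apply: le_lt_trans hj; rewrite -raddfB; exact: ler_Re_norm.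
have hIm : (fun j => complex.Im (u j)) @ F --> complex.Im l.
  apply/cvgrPdist_lt => e e0; have e0' : 0 < ofR e by rewrite (ltr_ofR 0).
  apply: filterS (h _ e0') => j hj.
  by rewrite -ltr_ofR; apply: le_lt_trans hj; rewrite -raddfB; exact: ler_Im_norm.
have -> : (fun j => nsq (u j)) =
  (fun j => complex.Re (u j) * complex.Re (u j) + complex.Im (u j) * complex.Im (u j)).
  by apply/funext => j; rewrite /nsq !expr2.
by rewrite /nsq !expr2; apply: cvgD; apply: cvgM.
Qed.

Variable n : nat.
Local Notation MI := (multiindex n).
Local Notation T := (n.-tuple (measurableTypeR R)).
Local Notation mu := (torus_measure R n).

Implicit Types (F : {fset MI}) (q d : MI -> C).

(** [multiindex] carries only a [choiceType] structure; the ascription exposes the finite functions,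
    whose countable structure provides [pickle]. *)
Definition code (a : MI) : nat := choice.pickle (a : {ffun 'I_n -> nat}).

(** Dominated convergence works along sequences, whereas unordered sums converge along all finite
    sets; this increasing sequence eventually contains each finite set. *)
Definition exhaustion (k : nat) : {fset MI} :=
  seq_fset tt (pmap (choice.unpickle : nat -> option {ffun 'I_n -> nat}) (iota 0 k) : seq MI).

Lemma exhaustionP (F : {fset MI}) :
  \forall k \near \oo, F `<=` exhaustion k.
Proof.
exists (\max_(a <- F) (code a).+1)%N => // k /= hk.
apply/fsubsetP => a aF; rewrite seq_fsetE mem_pmap.
apply/mapP; exists (code a); last by rewrite /code choice.pickleK.
rewrite mem_iota add0n /=; apply: leq_trans hk.
by rewrite (big_fsetD1 a)//= leq_maxl.
Qed.

Lemma hassum_exhaustion (x : MI -> C) l : hassum x l ->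
  (fun k => \sum_(a <- exhaustion k) x a) @ \oo --> l.
Proof.
move=> /hassumP h; apply/cvgrPdist_lt => e /h [F0 hF0].
by apply: filterS (exhaustionP F0) => k /hF0.
Qed.

(** Written as in [radial_limit], default value included, so that a radial limit is by conversion a
    limit of slices; for [0 <= r < 1] the default is never taken. *)
Definition slice (f : polydisc R n -> C) (r : R) (t : T) : C :=
  oapp f 0 (insub (ofR r *: torus_point t) : option (polydisc R n)).

Lemma norm_torus_point (r : R) (t : T) i : 0 <= r ->
  `|(ofR r *: torus_point t) ord0 i| = ofR r.
Proof.
move=> r0; rewrite !mxE normrM -/(cis (tnth t i)) norm_cis mulr1.
by rewrite normr_ofR ger0_norm.
Qed.

Lemma sliceP f r t : 0 <= r < 1 ->
  exists2 z : polydisc R n, val z = ofR r *: torus_point t & slice f r t = f z.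
Proof.
move=> /andP[r0 r1].
have hz : [forall i, `|(ofR r *: torus_point t) ord0 i| < 1].
  by apply/forallP => i; rewrite norm_torus_point// ltcR.
rewrite /slice; case: insubP => [z _ zE|/negP[]]; last exact: hz.
by exists z.
Qed.

Definition degree (a : MI) : nat := (\sum_(i < n) a i)%N.

Lemma monomialZ (a : MI) (k : C) z : monomial a (k *: z) = k ^+ degree a * monomial a z.
Proof.
rewrite /monomial /degree (big_morph (fun m => k ^+ m) (exprD k) (expr0 k)) -big_split.
apply: eq_bigr => i _.
by rewrite mxE exprMn.
Qed.

Lemma norm_monomial_torus a (t : T) : `|monomial a (torus_point t)| = 1 :> C.
Proof. by rewrite monomial_torus norm_cis. Qed.

Definition radial (q : MI -> C) (r : R) : MI -> C := fun a => q a * ofR r ^+ degree a.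

Lemma hassum_slice q g r t : is_taylor q g -> 0 <= r < 1 ->
  hassum (fun a => radial q r a * monomial a (torus_point t)) (slice g r t).
Proof.
move=> hq hr; have [z zE ->] := @sliceP g r t hr.
apply: eq_hassum (hq z) => a.
by rewrite zE monomialZ mulrA.
Qed.

(** Monomials have modulus 1 on the torus, so absolute convergence at the single point with all
    angles 0 bounds the series uniformly over the torus. *)
Lemma radial_summable q g r : is_taylor q g -> 0 <= r < 1 ->
  exists2 M : R, 0 <= M & forall F, \sum_(a <- F) `|radial q r a| <= ofR M.
Proof.
move=> hq hr; pose t : T := [tuple 0 | i < n].
have [M hM] := hassum_absbounded (@hassum_slice _ _ _ t hq hr).
have M0 : 0 <= M by have := hM fset0; rewrite big_seq_fset0.
have [m m0 eM] := ge0_ofR M0; exists m => // F; rewrite -eM.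
apply: le_trans (hM F); apply: ler_sum => a _.
by rewrite [leRHS]normrM norm_monomial_torus mulr1.
Qed.

Lemma nsq_norm_le (z : C) (M : R) : `|z| <= ofR M -> nsq z <= M ^+ 2.
Proof.
move=> h; rewrite -ler_ofR -normsq_nsq /ofR rmorphXn /=.
by rewrite lerXn2r// nnegrE//; exact: le_trans h.
Qed.

Lemma trig_norm_le F (d : MI -> C) (t : T) : `|trig F d t| <= \sum_(a <- F) `|d a|.
Proof.
apply: le_trans (ler_norm_sum _ _ _) _; apply: ler_sum => a _.
by rewrite normrM norm_monomial_torus mulr1.
Qed.

(** The uniform bound [M] dominates the partial sums, so the finite Parseval formula passes to the
    limit along [exhaustion]; the same pointwise limit makes the slice measurable. *)
Lemma parseval_radial q g r : is_taylor q g -> 0 <= r < 1 ->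
  bdmeas (fun t => nsq (slice g r t)) /\
  (fun k => \sum_(a <- exhaustion k) nsq (radial q r a)) @ \oo -->
    \int[mu]_t nsq (slice g r t).
Proof.
move=> hq hr; have [M M0 hM] := radial_summable hq hr.
have cv t : (fun k => nsq (trig (exhaustion k) (radial q r) t)) @ \oo -->
    nsq (slice g r t).
  by apply: cvg_nsq; exact: hassum_exhaustion (@hassum_slice _ _ _ t hq hr).
have bd k t : `|nsq (trig (exhaustion k) (radial q r) t)| <= M ^+ 2.
  rewrite ger0_norm ?nsq_ge0// nsq_norm_le//.
  exact: le_trans (trig_norm_le _ _ _) (hM _).
have bm k := bdmeas_nsq_trig (exhaustion k) (radial q r).
have bs : bdmeas (fun t => nsq (slice g r t)).
  split.
    apply: (@measurable_fun_cvg _ _ _ _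
      (fun k t => nsq (trig (exhaustion k) (radial q r) t))).
      by move=> k; case: (bm k).
    by move=> t _; exact: cv.
  exists (M ^+ 2) => t; rewrite ger0_norm ?nsq_ge0//.
  apply: nsq_norm_le; apply: hassum_norm_le (@hassum_slice _ _ _ t hq hr) => F.
  exact: le_trans (trig_norm_le _ _ _) (hM _).
split=> //.
under eq_fun do rewrite -integral_nsq_trig.
apply: (bounded_convergence (M := M ^+ 2)) => //.
  by move=> k; case: (bm k).
by apply: aeW => t; exact: cv.
Qed.

Lemma ler_sum_fset_real (x : MI -> R) F F' : (forall i, 0 <= x i) -> F `<=` F' ->
  \sum_(i <- F) x i <= \sum_(i <- F') x i.
Proof.
move=> x0 sub; rewrite -ler_ofR !ofR_sum.
by apply: ler_sum_fset => // i; rewrite (ler_ofR 0).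
Qed.

Lemma parseval_ge q g r F : is_taylor q g -> 0 <= r < 1 ->
  \sum_(a <- F) nsq (radial q r a) <= \int[mu]_t nsq (slice g r t).
Proof.
move=> hq hr; have [_ cv] := parseval_radial hq hr.
apply: (ler_cvg_to (cvg_cst _) cv).
apply: filterS (exhaustionP F) => k sub.
by apply: ler_sum_fset_real => // a; exact: nsq_ge0.
Qed.

Lemma nsq_radial q r a : nsq (radial q r a) = nsq (q a) * r ^+ (2 * degree a).
Proof.
rewrite /radial nsqM; congr (_ * _).
have -> : ofR r ^+ degree a = ofR (r ^+ degree a) by rewrite /ofR rmorphXn.
by rewrite /nsq /= expr0n addr0 -exprM mulnC.
Qed.

Lemma parseval_le q g r B : is_taylor q g -> 0 <= r < 1 ->
  (forall F, \sum_(a <- F) nsq (q a) <= B) -> \int[mu]_t nsq (slice g r t) <= B.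
Proof.
move=> hq hr hB; have [_ cv] := parseval_radial hq hr.
apply: (ler_cvg_to cv (cvg_cst B)); apply: nearW => k.
apply: le_trans (hB (exhaustion k)); apply: ler_sum => a _.
case/andP: hr => r0 r1.
by rewrite nsq_radial ler_piMr ?nsq_ge0// exprn_ile1// ltW.
Qed.

(** Parseval at one positive radius, here 1/2, bounds a positive multiple of each squared
    coefficient by the integral of zero. *)
Lemma taylor_unique0 q : is_taylor q (fun=> 0) -> q = fun=> 0.
Proof.
move=> hq; apply/funext => a.
have hr : 0 <= (2^-1 : R) < 1 by rewrite invr_ge0 ler0n invf_lt1 ?ltr1n.
have := parseval_ge [fset a] hq hr.
rewrite big_seq_fset1.
have -> : (fun t => nsq (slice (fun=> 0) 2^-1 t)) = (fun=> 0).
  by apply/funext => t; rewrite /slice; case: insub => [?|]; rewrite /nsq /= !expr0n addr0.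
rewrite Rintegral_prob_cst nsq_radial pmulr_lle0 ?exprn_gt0// => h.
have : nsq (q a) = 0 by apply/eqP; rewrite eq_le h nsq_ge0.
move=> h0; have := normsq_nsq (q a); rewrite h0.
by move/eqP; rewrite sqrf_eq0 normr_eq0 => /eqP.
Qed.

End RadialParseval.

(** * Passage to the boundary for an inner function times a polynomial *)

Section InnerIsometric.
Variables (R : realType) (n : nat).
Local Notation C := (Cx R).
Local Notation MI := (multiindex n).
Local Notation T := (n.-tuple (measurableTypeR R)).
Local Notation mu := (torus_measure R n).
Implicit Types (F : {fset MI}) (p q : MI -> C).

Definition radii (k : nat) : R := 1 - k.+2%:R^-1.

Lemma radii_itv k : 0 <= radii k < 1.
Proof.
by rewrite subr_ge0 invf_le1 ?ler1n//= gtrBl invr_gt0.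
Qed.

Lemma cvg_radii : radii @ \oo --> (1 : R).
Proof.
rewrite -[X in _ --> X]subr0; apply: cvgB; first exact: cvg_cst.
by have := @cvg_harmonic R; rewrite -cvg_shiftS.
Qed.

Lemma cvg_radiiX m : (fun k => radii k ^+ m) @ \oo --> (1 : R).
Proof.
elim: m => [|m IH]; first by under eq_fun do rewrite expr0; exact: cvg_cst.
have h := cvgM cvg_radii IH; rewrite mulr1 in h.
by under eq_fun do rewrite exprS; exact: h.
Qed.

Lemma cvg_trig_radii F p (t : T) :
  (fun k => trig F (radial p (radii k)) t) @ \oo --> trig F p t.
Proof.
apply/cvgrPdist_lt => e e0.
pose S : C := \sum_(a <- F) `|p a|.
have S0 : 0 < S + 1 by rewrite ltr_wpDl// sumr_ge0.
have [d d0 ed] : exists2 d : R, 0 < d & e / (S + 1) = ofR d.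
  by apply: gt0_ofR; rewrite divr_gt0.
(* Only finitely many degrees occur, so a single rank serves them all. *)
have near_all (s : seq MI) : \forall k \near \oo,
    forall a, a \in s -> `|1 - radii k ^+ degree a| < d.
  elim: s => [|a s IH]; first exact: nearW.
  have /cvgrPdist_lt/(_ _ d0) h := cvg_radiiX (degree a).
  apply: filterS2 IH h => k h1 h2 b; rewrite inE => /predU1P[->//|]; exact: h1.
apply: filterS (near_all F) => k hk.
rewrite /trig -sumrB.
apply: le_lt_trans (ler_norm_sum _ _ _) _.
apply: le_lt_trans (_ : \sum_(a <- F) `|p a| * ofR d < _); last first.
  by rewrite -mulr_suml -ed mulrCA gtr_pMr// ltr_pdivrMr// mul1r ltrDl.
rewrite big_seq [leRHS]big_seq; apply: ler_sum => a aF.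
rewrite -mulrBl normrM norm_monomial_torus mulr1.
have -> : p a - radial p (radii k) a = p a * ofR (1 - radii k ^+ degree a).
  by rewrite /ofR rmorphB rmorphXn rmorph1 mulrBr mulr1.
by rewrite normrM ler_wpM2l// normr_ofR ler_ofR ltW// hk.
Qed.

(** Here [|phi| = 1] almost everywhere is used. The slices are bounded by [M * N], with [N] the sum
    of the moduli of the coefficients of the polynomial, and in the limit the factor [phi] of
    modulus 1 drops out of the integrand. *)
Lemma inner_limit phi F p q : inner_function phi ->
  is_taylor q (fun z => phi z * \sum_(a <- F) p a * monomial a (val z)) ->
  (fun k => \int[mu]_t nsq (slice (fun z => phi z *
      \sum_(a <- F) p a * monomial a (val z)) (radii k) t)) @ \oo -->
  \sum_(a <- F) nsq (p a).
Proof.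
move=> [_ [M hM] hae] hq; rewrite -integral_nsq_trig.
set g := (X in slice X).
have M0 : 0 <= M.
  have [z _ _] := @sliceP _ _ phi _ [tuple 0 | i < n] (radii_itv 0).
  by rewrite -ler_ofR; exact: (le_trans (normr_ge0 (phi z)) (hM z)).
have sliceE k t : slice g (radii k) t =
    slice phi (radii k) t * trig F (radial p (radii k)) t.
  have [z zE ->] := @sliceP _ _ phi _ t (radii_itv k).
  rewrite /slice -zE valK /= /g; congr (_ * _).
  by apply: eq_bigr => a _; rewrite zE monomialZ mulrA.
pose N : R := complex.Re (\sum_(a <- F) `|p a|).
have NE : \sum_(a <- F) `|p a| = ofR N.
  have [m _ E] : exists2 m : R, 0 <= m & \sum_(a <- F) `|p a| = ofR m.
    by apply: ge0_ofR; exact: sumr_ge0.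
  by rewrite /N E.
apply: (bounded_convergence (M := (M * N) ^+ 2)).
- by move=> k; have [[]] := parseval_radial hq (radii_itv k).
- exact: bdmeas_nsq_trig.
- apply: filterS hae => t [l hl l1].
  under eq_fun do rewrite sliceE nsqM.
  have l1' : nsq l = 1 by apply: ofR_inj; rewrite -normsq_nsq l1 expr1n.
  have h : (fun k => nsq (slice phi (radii k) t)) @ \oo --> (1 : R).
    have hcv : (fun r => nsq (slice phi r t)) @ (1 : R)^'- --> nsq l by exact: cvg_nsq hl.
    rewrite -l1'; move/cvg_at_leftP : hcv; apply.
    split; last exact: cvg_radii.
    by move=> k; case/andP: (radii_itv k).
  have {}h := cvgM h (cvg_nsq _ (cvg_trig_radii (F := F) (p := p) (t := t))).
  by rewrite mul1r in h; exact: h.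
- move=> k t; rewrite ger0_norm ?nsq_ge0//; apply: nsq_norm_le.
  have -> : ofR (M * N) = ofR M * ofR N by exact: rmorphM.
  rewrite sliceE normrM; apply: ler_pM => //.
    by have [z _ ->] := @sliceP _ _ phi _ t (radii_itv k); exact: hM.
  rewrite -NE; apply: le_trans (trig_norm_le _ _ _) _.
  apply: ler_sum => a _; rewrite normrM normrX normr_ofR.
  have /andP[r0 r1] := radii_itv k.
  rewrite (ger0_norm r0) ler_piMr// exprn_ile1//; first by rewrite (ler_ofR 0).
  by rewrite (ler_ofR _ 1) ltW.
Qed.

(** With the next lemma this shows that multiplication by [phi] preserves the norm of polynomials.
    At each radius Parseval bounds a finite part of the radial sum by the integral, and then both
    sides pass to the limit. *)
Lemma inner_bound phi F p q F' : inner_function phi ->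
  is_taylor q (fun z => phi z * \sum_(a <- F) p a * monomial a (val z)) ->
  \sum_(a <- F') nsq (q a) <= \sum_(a <- F) nsq (p a).
Proof.
move=> hphi hq; apply: (ler_cvg_to _ (inner_limit hphi hq)); last first.
  by apply: nearW => k; exact: parseval_ge hq (radii_itv k).
elim: (F' : seq MI) => [|a s IH].
  by under eq_fun do rewrite big_nil; rewrite big_nil; exact: cvg_cst.
under eq_fun do rewrite big_cons nsq_radial.
have h := cvgM (cvg_cst (nsq (q a))) (cvg_radiiX (2 * degree a)).
rewrite mulr1 in h; have h2 := cvgD (h _ _) IH; rewrite big_cons; exact: h2.
Qed.

Lemma inner_bound_ge phi F p q B : inner_function phi ->
  is_taylor q (fun z => phi z * \sum_(a <- F) p a * monomial a (val z)) ->
  (forall F', \sum_(a <- F') nsq (q a) <= B) -> \sum_(a <- F) nsq (p a) <= B.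
Proof.
move=> hphi hq hB; apply: (ler_cvg_to (inner_limit hphi hq) (cvg_cst B)).
by apply: nearW => k; exact: parseval_le hq (radii_itv k) hB.
Qed.

End InnerIsometric.

(** * Multiplication by inner functions *)

Section Shift.
Variables (R : realType) (n : nat).
Local Notation C := (Cx R).
Local Notation MI := (multiindex n).
Implicit Types (a b : MI) (F : {fset MI}) (x y c : MI -> C).

Definition addm a b : MI := [ffun i => a i + b i]%N.
Definition subm a b : MI := [ffun i => a i - b i]%N.
Definition lem a b : bool := [forall i, a i <= b i]%N.

Lemma addmK b a : subm (addm a b) b = a.
Proof. by apply/ffunP => i; rewrite !ffunE addnK. Qed.

Lemma submK b a : lem b a -> addm (subm a b) b = a.
Proof. by move=> /forallP h; apply/ffunP => i; rewrite !ffunE subnK. Qed.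

Lemma lem_addl b a : lem b (addm a b).
Proof. by apply/forallP => i; rewrite ffunE leq_addl. Qed.

Lemma monomialD a b (z : 'rV[C]_n) :
  monomial (addm a b) z = monomial a z * monomial b z.
Proof.
by rewrite /monomial -big_split; apply: eq_bigr => i _; rewrite ffunE exprD.
Qed.

(** Multiplication by [z^b] on coefficients; the test guards against the truncation at 0 in
    [subm]. *)
Definition mshift b c : MI -> C := fun a => if lem b a then c (subm a b) else 0.

Lemma mshiftD b c a : mshift b c (addm a b) = c a.
Proof. by rewrite /mshift lem_addl addmK. Qed.

Lemma sum_mshift b x F : \sum_(a <- F) mshift b x a =
  \sum_(a <- (subm^~ b) @` [fset a in F | lem b a]) x a.
Proof.
rewrite big_imfset /=; last first.
  move=> a a'; rewrite !inE /= => /andP[_ h] /andP[_ h'] e.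
  by rewrite -(submK h) e submK.
by rewrite -big_fset_condE /mshift -big_mkcond.
Qed.

Lemma hassum_mshift b x l : hassum x l -> hassum (mshift b x) l.
Proof.
move=> /hassumP h; apply/hassumP => e /h [F0 hF0].
exists ((addm^~ b) @` F0) => F sub; rewrite sum_mshift; apply: hF0.
apply/fsubsetP => a aF; apply/imfsetP; exists (addm a b); last by rewrite addmK.
rewrite !inE /= lem_addl andbT; apply: (fsubsetP sub).
by apply/imfsetP; exists a.
Qed.

Lemma L2_mshift b c : L2 c -> L2 (mshift b c).
Proof.
move=> [M hM].
have [|l hl] := @absbounded_hassum R MI (fun a => `|c a| ^+ 2).
  by exists M => F; under eq_bigr do rewrite ger0_norm ?exprn_ge0//.
exists l => F; apply: (@hassum_ge_sum _ _ (fun a => `|mshift b c a| ^+ 2)).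
  by move=> a; rewrite exprn_ge0.
apply: eq_hassum (hassum_mshift b hl) => a.
by rewrite /mshift; case: ifP => // _; rewrite normr0 expr0n.
Qed.

Lemma is_taylor_mshift b c (f : polydisc R n -> C) : is_taylor c f ->
  is_taylor (mshift b c) (fun z => f z * monomial b (val z)).
Proof.
move=> hc z; rewrite mulrC.
have := hassumZ (monomial b (val z)) (hassum_mshift b (hc z)).
apply: eq_hassum => a; rewrite /mshift; case: ifP => [ba|_]; last by rewrite mulr0 mul0r.
by rewrite mulrCA; congr (_ * _); rewrite mulrC -monomialD submK.
Qed.

Lemma is_taylorD x y f g : is_taylor x f -> is_taylor y g ->
  is_taylor (x + y) (fun z : polydisc R n => f z + g z).
Proof.
move=> hx hy z; apply: eq_hassum (hassumD (hx z) (hy z)) => a.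
by rewrite -mulrDl.
Qed.

Lemma is_taylorZ k x f : is_taylor x f ->
  is_taylor (scl k x) (fun z : polydisc R n => k * f z).
Proof.
move=> hx z; apply: eq_hassum (hassumZ k (hx z)) => a.
by rewrite mulrA.
Qed.

Lemma taylor_unique x y (f : polydisc R n -> C) : is_taylor x f -> is_taylor y f -> x = y.
Proof.
move=> hx hy; apply/eqP; rewrite -subr_eq0; apply/eqP.
apply: (@taylor_unique0 R n) => z.
have h : is_taylor _ _ := is_taylorD hx (@is_taylorZ (-1) _ _ hy).
by have := h z; rewrite sclN1 mulN1r subrr.
Qed.

Lemma taylorE x (f : polydisc R n -> C) : is_taylor x f -> taylor f = x.
Proof.
move=> hx; have : is_taylor (taylor f) f 
  by apply: (@xgetPex _ _ [set c | is_taylor c f]); exists x.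
by move=> h; exact: taylor_unique h hx.
Qed.

Lemma geometric_sum_le (s : C) m : 0 <= s < 1 -> \sum_(k < m) s ^+ k <= (1 - s)^-1.
Proof.
move=> /andP[s0 s1]; have d0 : 0 < 1 - s by rewrite subr_gt0.
rewrite -[leRHS]mul1r ler_pdivlMr//.
have -> : (\sum_(k < m) s ^+ k) * (1 - s) = 1 - s ^+ m.
  by rewrite -[1 in RHS](expr1n _ m) subrXX mulrC; congr (_ * _);
    apply: eq_bigr => k _; rewrite expr1n mul1r.
by rewrite gerBl exprn_ge0.
Qed.

(** [F] lies in the box of multi-indices with entries at most [m], over which the sum factors into
    [n] finite geometric sums. *)
Lemma sum_prod_geometric (s : 'I_n -> C) F : (forall i, 0 <= s i < 1) ->
  \sum_(a <- F) \prod_(i < n) s i ^+ (a i) <= \prod_(i < n) (1 - s i)^-1.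
Proof.
move=> hs.
have s0 i : 0 <= s i by case/andP: (hs i).
pose m := (\max_(a <- F) \max_(i < n) a i)%N.
pose f (u : {ffun 'I_n -> 'I_m.+1}) : MI := [ffun i => u i : nat].
have f_inj : injective f.
  move=> u v /ffunP e; apply/ffunP => i; apply: val_inj.
  by have := e i; rewrite !ffunE.
apply: (@le_trans _ _ (\sum_(u : {ffun 'I_n -> 'I_m.+1}) \prod_(i < n) s i ^+ (u i))).
  apply: (@le_trans _ _ (\sum_(a <- f @` [fset u in {: {ffun 'I_n -> 'I_m.+1}}])
      \prod_(i < n) s i ^+ (a i))).
    apply: (@ler_sum_fset _ _ (fun a => \prod_(i < n) s i ^+ (a i))).
      by move=> a; apply: prodr_ge0 => i _; rewrite exprn_ge0.
    apply/fsubsetP => a aF; apply/imfsetP.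
    exists [ffun i => inord (a i)]; first by rewrite !inE.
    apply/ffunP => i; rewrite !ffunE inordK// ltnS /m.
    by rewrite (big_fsetD1 a)//=; apply: leq_trans (leq_maxl _ _); exact: leq_bigmax.
  rewrite big_imfset /=; last by move=> u v _ _; exact: f_inj.
  rewrite big_imfset /=; last by []. rewrite big_enum /=.
  by apply: ler_sum => u _; under eq_bigr do rewrite ffunE.
rewrite -(bigA_distr_bigA (fun i (k : 'I_m.+1) => s i ^+ k)).
apply: ler_prod => i _; rewrite geometric_sum_le// andbT.
by apply: sumr_ge0 => k _; rewrite exprn_ge0.
Qed.

(* The Szego kernel: pairing with it evaluates at [z]. *)
Definition pointker (z : polydisc R n) : MI -> C := fun a => (monomial a (val z))^*.

Lemma L2_pointker z : L2 (pointker z).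
Proof.
exists (\prod_(i < n) (1 - `|val z ord0 i| ^+ 2)^-1) => F.
apply: le_trans (sum_prod_geometric F (s := fun i => `|val z ord0 i| ^+ 2) _) => [|i].
  apply: ler_sum => a _; rewrite norm_conjC /monomial normr_prod -prodrXl.
  by under eq_bigr do rewrite normrX exprAC.
rewrite exprn_ge0//= expr_lt1//.
by have /forallP := valP z; apply.
Qed.

Definition ev x (z : polydisc R n) : C := ip x (pointker z).

Lemma taylor_ev x : L2 x -> is_taylor x (ev x).
Proof.
move=> hx z; apply: eq_hassum (hassum_ip hx (L2_pointker z)) => a.
by rewrite /pointker conjCK.
Qed.

Lemma evE x f : L2 x -> is_taylor x f -> ev x = f.
Proof.
move=> hx hf; apply/funext => z.
by apply: (@hassum_unique _ _ (fun a => x a * monomial a (val z))); [exact: taylor_ev|exact: hf].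
Qed.

Lemma ev_inj x y : L2 x -> L2 y -> ev x = ev y -> x = y.
Proof.
move=> hx hy e; apply: (@taylor_unique _ _ (ev x)); first exact: taylor_ev.
by rewrite e; exact: taylor_ev.
Qed.

Lemma square_summableP x : square_summable x <-> L2 x.
Proof.
have ReE (z : C) : complex.Re (`|z| ^+ 2) = nsq z by rewrite normsq_nsq.
have sumE F : \sum_(a <- F) `|x a| ^+ 2 = ofR (\sum_(a <- F) nsq (x a)).
  by rewrite ofR_sum; apply: eq_bigr => a _; rewrite normsq_nsq.
have absE : (fun a => `|(complex.Re (`|x a| ^+ 2))%:E|%E) = (fun a => (nsq (x a))%:E).
  by apply/funext => a; rewrite ReE abse_EFin ger0_norm ?nsq_ge0.
rewrite /square_summable /summable absE; split=> [fin|[M hM]].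
  exists (ofR (fine (\esum_(a in [set: MI]) (nsq (x a))%:E))) => F.
  rewrite sumE ler_ofR -lee_fin fineK; last first.
    by rewrite ge0_fin_numE// esum_ge0// => a _; rewrite lee_fin nsq_ge0.
  apply: esum_ge; exists [set` F]; first by split.
  by rewrite fsbig_finite// set_fsetK -sumEFin.
have M0 : 0 <= M by have := hM fset0; rewrite big_seq_fset0.
have [m _ eM] := ge0_ofR M0.
apply: (@le_lt_trans _ _ m%:E); last exact: ltry.
apply: ge_ereal_sup => _ [A [finA _] <-].
rewrite fsbig_finite//= sumEFin lee_fin -ler_ofR -sumE -eM.
exact: hM.
Qed.

Lemma H2P f : H2 f <-> exists2 x, L2 x & f = ev x.
Proof.
split=> [[[x hx] /square_summableP]|[x hx ->]].
  by rewrite (taylorE hx) => h; exists x => //; rewrite (evE h hx).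
split; first by exists x; exact: taylor_ev.
by rewrite (taylorE (taylor_ev hx)); apply/square_summableP.
Qed.

Lemma H2_inner_ev x y : L2 x -> L2 y -> H2_inner (ev x) (ev y) = ip x y.
Proof.
move=> hx hy; rewrite /H2_inner (taylorE (taylor_ev hx)) (taylorE (taylor_ev hy)).
by [].
Qed.

Lemma evB x y z : L2 x -> L2 y -> ev (x - y) z = ev x z - ev y z.
Proof. by move=> hx hy; rewrite /ev ipBl//; exact: L2_pointker. Qed.

End Shift.

(** * Toeplitz operators and projections attached to inner functions *)

Section InnerOperators.
Variables (R : realType) (n : nat).
Local Notation C := (Cx R).
Local Notation MI := (multiindex n).
Implicit Types (a b : MI) (F : {fset MI}) (x y c g h : MI -> C).

Lemma inner_norm (phi : polydisc R n -> C) F p q : inner_function phi ->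
  is_taylor q (fun z => phi z * \sum_(a <- F) p a * monomial a (val z)) ->
  L2 q /\ ip q q = ofR (\sum_(a <- F) nsq (p a)).
Proof.
move=> hphi hq.
have sumE x (G : {fset MI}) : \sum_(a <- G) `|x a| ^+ 2 = ofR (\sum_(a <- G) nsq (x a)).
  by rewrite ofR_sum; apply: eq_bigr => a _; rewrite normsq_nsq.
have le (G : {fset MI}) : \sum_(a <- G) `|q a| ^+ 2 <= ofR (\sum_(a <- F) nsq (p a)).
  by rewrite sumE ler_ofR; exact: (inner_bound G hphi hq).
have Lq : L2 q by eexists; exact: le.
split=> //; apply/eqP; rewrite eq_le ip_le//=.
have [s _ sE] := ge0_ofR (ip_ge0 Lq).
rewrite sE ler_ofR; apply: inner_bound_ge hphi hq _ => G.
by rewrite -ler_ofR -sE -sumE; exact: ip_sum_le.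
Qed.

(** The coefficient form of innerness: the functions [z^b phi] are orthonormal, so multiplication by
    [phi] is an isometry of H^2. The operator arguments use inner functions only through this
    property. *)
Definition isometric c : Prop := orthofamily (fun b => mshift b c).

(* Polarization of [inner_norm] with [z^b + k z^b'] for [k = 1] and [k = i]. *)
Lemma inner_isometric (phi : polydisc R n -> C) c : inner_function phi ->
  is_taylor c phi -> isometric c.
Proof.
move=> hphi hc.
have h1 b : L2 (mshift b c) /\ ip (mshift b c) (mshift b c) = 1.
  have ht : is_taylor (mshift b c) (fun z => phi z *
      \sum_(a <- [fset b]) delta R b a * monomial a (val z)).
    have -> : (fun z => phi z * \sum_(a <- [fset b]) delta R b a * monomial a (val z)) =
        (fun z => phi z * monomial b (val z)).
      by apply/funext => z; rewrite big_seq_fset1 /delta eqxx mul1r.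
    exact: is_taylor_mshift.
  have [hL ->] := inner_norm hphi ht.
  split; first exact: hL.
  by rewrite big_seq_fset1 /delta eqxx /nsq /= expr0n addr0 expr1n.
split=> [b|b b']; first by case: (h1 b).
have [->|bb'] := eqVneq b b'; first by case: (h1 b').
have [Lb ib] := h1 b; have [Lb' ib'] := h1 b'.
set X := ip _ _.
have key (k : C) : k^* * X + k * X^* = 0.
  pose p a : C := if a == b then 1 else k.
  have ht : is_taylor (mshift b c + scl k (mshift b' c)) (fun z => phi z *
      \sum_(a <- [fset b; b']) p a * monomial a (val z)).
    have -> : (fun z => phi z * \sum_(a <- [fset b; b']) p a * monomial a (val z)) =
        (fun z => phi z * monomial b (val z) + k * (phi z * monomial b' (val z))).
      apply/funext => z; rewrite big_fsetU1 ?inE//= big_seq_fset1 /p eqxx eq_sym (negbTE bb').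
      by ring.
    apply: (@is_taylorD _ _ _ _ (fun z => phi z * monomial b (val z))
      (fun z => k * (phi z * monomial b' (val z)))); first exact: is_taylor_mshift.
    by apply: (@is_taylorZ _ _ _ _ (fun z => phi z * monomial b' (val z))); exact: is_taylor_mshift.
  have [_] := inner_norm hphi ht; rewrite /p.
  rewrite big_fsetU1 ?inE//= big_seq_fset1 eqxx eq_sym (negbTE bb').
  have hZ := L2Z k Lb'.
  rewrite (ipDl Lb hZ (L2D Lb hZ)) (ipDr Lb Lb hZ) (ipDr hZ Lb hZ).
  rewrite (ipZr k Lb Lb') (ipZl k Lb' Lb) (ipZl k Lb' hZ) (ipZr k Lb' Lb') ib ib'.
  have -> : ofR (nsq 1 + nsq k) = ofR (nsq 1) + ofR (nsq k) by exact: rmorphD.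
  rewrite (ipC Lb Lb') -/X -!normsq_nsq normr1 expr1n normCK => e.
  apply: (addrI (1 + k * k^*)); rewrite addr0 -[RHS]e; ring.
have := key 1; have := key 'i%C.
have -> : ('i%C : C)^* = - 'i%C by rewrite /Num.conj /=; congr Complex; rewrite oppr0.
rewrite rmorph1 !mul1r mulNr => /eqP; rewrite addrC -mulrBr mulf_eq0.
have /negbTE -> : 'i%C != 0 :> C by rewrite eq_complex /= oner_eq0 andbF.
rewrite subr_eq0 => /eqP -> /eqP; rewrite -mulr2n mulrn_eq0 /= => /eqP.
by [].
Qed.

(* The Toeplitz operators [T_phi] and [T_phi^*] on coefficients, for [phi] with coefficients [c]. *)
Definition mulop c : (MI -> C) -> MI -> C := Vop (fun b => mshift b c).
Definition adjop c : (MI -> C) -> MI -> C := Vsop (fun b => mshift b c).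

Lemma adjopE c g a : adjop c g a = ip g (mshift a c).
Proof. by []. Qed.

Lemma mshift0 c : mshift [ffun=> 0%N] c = c.
Proof.
apply/funext => a; rewrite /mshift ifT; last by apply/forallP => i; rewrite ffunE.
by congr c; apply/ffunP => i; rewrite !ffunE subn0.
Qed.

Lemma isometric_L2 c : isometric c -> L2 c.
Proof. by move=> [/(_ [ffun=> 0%N]) hc _]; rewrite mshift0 in hc. Qed.

Lemma ev_mshift b c z : L2 c -> ev (mshift b c) z = ev c z * monomial b (val z).
Proof.
move=> hc; rewrite (@evE _ _ _ (fun z => ev c z * monomial b (val z)))//.
  exact: L2_mshift.
by apply: is_taylor_mshift; exact: taylor_ev.
Qed.

Lemma L2_mulop c h : isometric c -> L2 h -> L2 (mulop c h).
Proof. exact: L2_Vop. Qed.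

Lemma L2_adjop c h : isometric c -> L2 h -> L2 (adjop c h).
Proof. exact: L2_Vs. Qed.

(** The kernel is an eigenvector of the adjoint: [T_phi^*] maps [pointker z] to the conjugate of
    [phi z] times [pointker z]. Pairing [h] with this gives the product of values. *)
Lemma ev_mulop c h z : isometric c -> L2 h ->
  ev (mulop c h) z = ev c z * ev h z.
Proof.
move=> ic hh; have hk := L2_pointker z; have hc := isometric_L2 ic.
have e : ip (pointker z) (mulop c h) = (ev c z * ev h z)^*.
  rewrite Vop_adj//; apply: ipE.
  have h1 : hassum (fun a => h a * monomial a (val z)) (ev h z) by exact: taylor_ev.
  apply: eq_hassum (hassum_conj (hassumZ (ev c z) h1)) => b.
  have hb := L2_mshift b hc.
  have -> : Vsop (fun b => mshift b c) (pointker z) b = (ev c z * monomial b (val z))^*.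
    by rewrite /Vsop (ipC hb hk) -ev_mshift.
  by rewrite -rmorphM /= mulrA mulrAC.
by rewrite /ev ipC ?e ?conjCK//; exact: L2_mulop.
Qed.

Lemma mulopC c d h : isometric c -> isometric d -> L2 h ->
  mulop c (mulop d h) = mulop d (mulop c h).
Proof.
move=> ic id hh.
have L1 : L2 (mulop d h) := L2_mulop id hh.
have L2' : L2 (mulop c h) := L2_mulop ic hh.
apply: ev_inj; [exact: L2_mulop|exact: L2_mulop|apply/funext => z].
rewrite (ev_mulop z ic L1) (ev_mulop z id hh) (ev_mulop z id L2') (ev_mulop z ic hh).
exact: mulrCA.
Qed.

Lemma inner_rep (phi : polydisc R n -> C) : inner_function phi ->
  exists2 c, isometric c & phi = ev c.
Proof.
move=> hphi; have [[c hc] _ _] := hphi; exists c; first exact: inner_isometric hphi hc.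
by rewrite (evE _ hc)//; apply: isometric_L2; exact: inner_isometric hphi hc.
Qed.

Lemma mulH2P c f : isometric c ->
  mulH2 (ev c) f <-> exists2 h, L2 h & f = ev (mulop c h).
Proof.
move=> ic; split=> [[g /H2P[h hh ->] <-]|[h hh ->]].
  by exists h => //; apply/funext => z; rewrite ev_mulop.
exists (ev h); first by apply/H2P; exists h.
by apply/funext => z; rewrite ev_mulop.
Qed.

Lemma ip_eq0r x : L2 x -> (forall y, L2 y -> ip x y = 0) -> x = 0.
Proof. by move=> hx /(_ x hx); exact: ip_eq0. Qed.

(** [orthoproj] picks its value by choice, so orthogonality has to determine it. As [mulop c] is
    isometric, the relation for a candidate [mulop c h] says that [adjop c g - h] is orthogonal to
    everything. *)
Lemma P_ev c g : isometric c -> L2 g ->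
  P_ (ev c) (ev g) = ev (mulop c (adjop c g)).
Proof.
move=> ic hg; rewrite /P_ /orthoproj.
set S := [set p | _].
have La : L2 (adjop c g) := L2_adjop ic hg.
have Lp : L2 (mulop c (adjop c g)) := L2_mulop ic La.
have orth h k : L2 h -> L2 k ->
    H2_inner (fun z => ev g z - ev (mulop c h) z) (ev (mulop c k)) = ip (adjop c g - h) k.
  move=> hh hk; have Lh := L2_mulop ic hh; have Lk := L2_mulop ic hk.
  have -> : (fun z => ev g z - ev (mulop c h) z) = ev (g - mulop c h).
    by apply/funext => z; rewrite evB.
  rewrite H2_inner_ev//; last exact: L2B.
  rewrite ipBl// [ip g _]Vop_adj// [ip (mulop c h) _]ip_Vop//.
  by rewrite ipBl.
have SP : S (ev (mulop c (adjop c g))).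
  split; first by apply/(mulH2P _ ic); exists (adjop c g).
  by move=> _ /(mulH2P _ ic)[k hk ->]; rewrite orth// subrr ip0l.
have SU q : S q -> q = ev (mulop c (adjop c g)).
  move=> [/(mulH2P _ ic)[h hh ->] hq].
  have -> : adjop c g = h; last by [].
  apply/eqP; rewrite -subr_eq0; apply/eqP; apply: ip_eq0r; first exact: L2B.
  by move=> k hk; rewrite -orth//; apply: hq; apply/(mulH2P _ ic); exists k.
by apply: SU; apply: (@xgetPex _ _ S); exists (ev (mulop c (adjop c g))).
Qed.

Definition comm c d x : MI -> C :=
  mulop c (adjop c (mulop d (adjop d x))) - mulop d (adjop d (mulop c (adjop c x))).

Lemma commutator_ev c d x : isometric c -> isometric d -> L2 x ->
  commutator (P_ (ev c)) (P_ (ev d)) (ev x) = ev (comm c d x).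
Proof.
move=> ic id hx.
have Lc y : L2 y -> L2 (mulop c (adjop c y)).
  by move=> hy; apply: L2_mulop => //; exact: L2_adjop.
have Ld y : L2 y -> L2 (mulop d (adjop d y)).
  by move=> hy; apply: L2_mulop => //; exact: L2_adjop.
apply/funext => z; rewrite /commutator /comm.
rewrite [P_ (ev d) (ev x)]P_ev// [P_ (ev c) (ev x)]P_ev//.
rewrite P_ev//; last exact: Ld.
rewrite P_ev//; last exact: Lc.
by rewrite evB//; [apply: Lc; exact: Ld|apply: Ld; exact: Lc].
Qed.

Lemma coprime_mulop c d h k : isometric c -> isometric d ->
  coprime_inner (ev c) (ev d) -> L2 h -> L2 k -> mulop c h = mulop d k ->
  exists2 l, L2 l & mulop c h = mulop c (mulop d l).
Proof.
move=> ic id co hh hk e.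
have : mulH2 (fun z => ev c z * ev d z) (ev (mulop c h)).
  rewrite -co; split; first by apply/(mulH2P _ ic); exists h.
  by apply/(mulH2P _ id); exists k; [exact: hk|rewrite e].
move=> [f /H2P[l hl ->] E]; exists l; first exact: hl.
have Ll := L2_mulop id hl.
apply: ev_inj; [exact: L2_mulop|exact: L2_mulop|rewrite -E].
by apply/funext => z; rewrite (ev_mulop z ic Ll) (ev_mulop z id hl) mulrA.
Qed.

End InnerOperators.

(** * Commutation and finite rank *)

Section Commutation.
Variables (R : realType) (n : nat).
Local Notation C := (Cx R).
Local Notation MI := (multiindex n).
Implicit Types (a b : MI) (F : {fset MI}) (x y c d g h : MI -> C).

Lemma ip_adjop c g h : isometric c -> L2 g -> L2 h ->
  ip (adjop c g) h = ip g (mulop c h).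
Proof. by move=> ic hg hh; rewrite [RHS]Vop_adj. Qed.

Lemma adjopK c h : isometric c -> L2 h -> adjop c (mulop c h) = h.
Proof. exact: VsVop. Qed.

Lemma ip_ext x y : L2 x -> L2 y -> (forall k, L2 k -> ip x k = ip y k) -> x = y.
Proof.
move=> hx hy h; apply/eqP; rewrite -subr_eq0; apply/eqP.
apply: ip_eq0r; first exact: L2B.
by move=> k hk; rewrite ipBl// h// subrr.
Qed.

Lemma adjopC c d x : isometric c -> isometric d -> L2 x ->
  adjop c (adjop d x) = adjop d (adjop c x).
Proof.
move=> ic id hx.
have hc := L2_adjop ic hx; have hd := L2_adjop id hx.
apply: ip_ext; [exact: L2_adjop|exact: L2_adjop|move=> k hk].
have kc := L2_mulop ic hk; have kd := L2_mulop id hk.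
rewrite (ip_adjop ic hd hk) (ip_adjop id hx kc) (ip_adjop id hc hk) (ip_adjop ic hx kd).
by rewrite (mulopC ic id hk).
Qed.

(** Restricted to square-summable families because [ip] is additive only where the underlying sums
    converge. *)
Definition linear_on_L2 (T : (MI -> C) -> MI -> C) : Prop :=
  [/\ forall x, L2 x -> L2 (T x),
      forall x y, L2 x -> L2 y -> T (x + y) = T x + T y
    & forall k x, L2 x -> T (scl k x) = scl k (T x)].

Lemma linear_mulop c : isometric c -> linear_on_L2 (mulop c).
Proof.
move=> ic; split=> [x hx|x y hx hy|k x hx].
- exact: L2_mulop.
- exact: VopD.
- exact: VopZ.
Qed.

Lemma linear_adjop c : isometric c -> linear_on_L2 (adjop c).
Proof.
move=> ic; split=> [x hx|x y hx hy|k x hx].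
- exact: L2_adjop.
- exact: VsD.
- exact: VsZ.
Qed.

Lemma linear_comp T U : linear_on_L2 T -> linear_on_L2 U ->
  linear_on_L2 (fun x => T (U x)).
Proof.
move=> [T1 T2 T3] [U1 U2 U3]; split=> [x hx|x y hx hy|k x hx].
- exact/T1/U1.
- by rewrite U2// T2//; exact: U1.
- by rewrite U3// T3//; exact: U1.
Qed.

Lemma linear_sub T U : linear_on_L2 T -> linear_on_L2 U ->
  linear_on_L2 (fun x => T x - U x).
Proof.
move=> [T1 T2 T3] [U1 U2 U3]; split=> [x hx|x y hx hy|k x hx].
- by apply: L2B; [exact: T1|exact: U1].
- by rewrite T2// U2// opprD addrACA.
- rewrite T3// U3//; apply/funext => a.
  by rewrite /scl /GRing.add /= /GRing.opp /= mulrBr.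
Qed.

Lemma linear_comm c d : isometric c -> isometric d -> linear_on_L2 (comm c d).
Proof.
move=> ic id; have lc := linear_mulop ic; have ld := linear_mulop id.
have ac := linear_adjop ic; have ad := linear_adjop id.
apply: linear_sub.
  exact: (linear_comp lc (linear_comp ac (linear_comp ld ad))).
exact: (linear_comp ld (linear_comp ad (linear_comp lc ac))).
Qed.

Lemma linear0 T : linear_on_L2 T -> T 0 = 0.
Proof.
move=> [_ T2 _]; have := T2 0 0 (L2_0 R _) (L2_0 R _).
by rewrite addr0 => /eqP; rewrite eq_sym -subr_eq0 addrK => /eqP.
Qed.

Lemma linear_comb T (N : nat) (p : 'I_N -> C) (x : 'I_N -> MI -> C) :
  linear_on_L2 T -> (forall k, L2 (x k)) ->
  T (\sum_(k < N) scl (p k) (x k)) = \sum_(k < N) scl (p k) (T (x k)).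
Proof.
move=> lT hx; have [T1 T2 T3] := lT.
have hZ k := L2Z (p k) (hx k).
suff [] : L2 (\sum_(k < N) scl (p k) (x k)) /\
  T (\sum_(k < N) scl (p k) (x k)) = \sum_(k < N) scl (p k) (T (x k)) by [].
elim/big_rec2 : _ => [|k y z _ [hz IH]]; first by split; [exact: L2_0|exact: linear0].
by split; [exact: L2D|rewrite T2// T3// IH].
Qed.

(* Both sides have at [b] at most one nonzero term, sitting at the coordinatewise maximum,
   respectively minimum, of [a] and [b]. *)
Lemma adjop_mulop_delta c d a : isometric c -> isometric d ->
  (forall e e' i, c e != 0 -> d e' != 0 -> e i = 0%N \/ e' i = 0%N) ->
  adjop d (mulop c (delta R a)) = mulop c (adjop d (delta R a)).
Proof.
move=> ic id dis; have hc := isometric_L2 ic; have hd := isometric_L2 id.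
pose mx b : MI := [ffun i => maxn (a i) (b i)].
pose mn b : MI := [ffun i => minn (a i) (b i)].
apply/funext => b.
have -> : adjop d (mulop c (delta R a)) b = ip (mshift a c) (mshift b d).
  by rewrite /adjop /mulop Vop_delta.
have -> : mulop c (adjop d (delta R a)) b = ip (adjop d (delta R a)) (adjop c (delta R b)) by [].
have -> : ip (mshift a c) (mshift b d) = c (subm (mx b) a) * (d (subm (mx b) b))^*.
  apply: ipE.
  have -> : c (subm (mx b) a) * (d (subm (mx b) b))^* =
      (fun e => mshift a c e * (mshift b d e)^*) (mx b).
    rewrite /mshift !ifT//; apply/forallP => i; rewrite ffunE.
      exact: leq_maxr.
    exact: leq_maxl.
  apply: hassum1 => e ne; apply/eqP; move: ne; apply: contraNT; rewrite /mshift.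
  case: ifP => [/forallP ae|_]; last by rewrite mul0r eqxx.
  case: ifP => [/forallP be|_]; last by rewrite rmorph0 mulr0 eqxx.
  rewrite mulf_eq0 conjC_eq0 negb_or => /andP[ce de].
  apply/eqP/ffunP => i; rewrite ffunE.
  have := dis _ _ i ce de; rewrite !ffunE.
  by have := ae i; have := be i; lia.
symmetry; apply: ipE.
have adjE (f : MI -> C) e e' : L2 f -> adjop f (delta R e) e' = (mshift e' f e)^*.
  by move=> hf; rewrite adjopE ip_deltal//; exact: L2_mshift.
have -> : c (subm (mx b) a) * (d (subm (mx b) b))^* =
    (fun e => adjop d (delta R a) e * (adjop c (delta R b) e)^*) (mn b).
  rewrite !adjE// conjCK /mshift !ifT; last 2 first.
  - by apply/forallP => i; rewrite ffunE geq_min leqnn ?orbT.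
  - by apply/forallP => i; rewrite ffunE geq_min leqnn ?orbT.
  rewrite mulrC; congr ((d _)^* * c _); apply/ffunP => i; rewrite !ffunE; lia.
apply: hassum1 => e ne; apply/eqP; move: ne; apply: contraNT; rewrite !adjE// conjCK /mshift.
case: ifP => [/forallP ae|_]; last by rewrite rmorph0 mul0r eqxx.
case: ifP => [/forallP be|_]; last by rewrite mulr0 eqxx.
rewrite mulf_eq0 conjC_eq0 negb_or => /andP[de ce].
apply/eqP/ffunP => i; rewrite ffunE.
have := dis _ _ i ce de; rewrite !ffunE.
by have := ae i; have := be i; lia.
Qed.

(** The coefficient at [a] is a pairing with [delta R a], so taking adjoints moves the claim onto
    the basis vectors, where [adjop_mulop_delta] applies. *)
Lemma adjop_mulop_disjoint c d x : isometric c -> isometric d -> L2 x ->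
  (forall e e' i, c e != 0 -> d e' != 0 -> e i = 0%N \/ e' i = 0%N) ->
  adjop c (mulop d x) = mulop d (adjop c x).
Proof.
move=> ic id hx dis; apply/funext => a.
have hdx := L2_mulop id hx; have hcx := L2_adjop ic hx.
have da := L2_delta R a; have hca := L2_mulop ic da; have hda := L2_adjop id da.
rewrite -[LHS]ip_delta -[RHS]ip_delta.
rewrite (ip_adjop ic hdx da) (ipC hca hdx) -(ip_adjop id hca hx).
rewrite (adjop_mulop_delta a ic id dis) -(ipC (L2_mulop ic hda) hx).
rewrite -(ip_adjop ic hx hda) (ipC hda hcx) (ip_adjop id da hcx).
by rewrite -(ipC da (L2_mulop id hcx)).
Qed.

(** Moving the inner adjoint past the multiplier turns the two products into [T_c T_d T_c^* T_d^*]
    and [T_d T_c T_d^* T_c^*], which agree because multipliers commute and so do their adjoints. *)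
Lemma comm0_disjoint c d x : isometric c -> isometric d -> L2 x ->
  (forall e e' i, c e != 0 -> d e' != 0 -> e i = 0%N \/ e' i = 0%N) ->
  comm c d x = 0.
Proof.
move=> ic id hx dis; have hcx := L2_adjop ic hx; have hdx := L2_adjop id hx.
have dis' e e' i : d e != 0 -> c e' != 0 -> e i = 0%N \/ e' i = 0%N.
  by move=> h1 h2; case: (dis _ _ i h2 h1) => ?; [right|left].
rewrite /comm (adjop_mulop_disjoint ic id hdx dis) (adjop_mulop_disjoint id ic hcx dis').
rewrite (adjopC ic id hx) (mulopC ic id); last exact: L2_adjop.
by rewrite subrr.
Qed.

(* [T_c T_c^* T_d f] lies in the ranges of both [T_c] and [T_d], hence equals [T_c T_d l];
   cancelling isometries gives [l = T_c^* f]. *)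
Lemma coprime_commute c d f : isometric c -> isometric d ->
  coprime_inner (ev c) (ev d) -> L2 f -> comm c d (mulop d f) = 0 ->
  adjop c (mulop d f) = mulop d (adjop c f).
Proof.
move=> ic id co hf; have hdf := L2_mulop id hf; have hh := L2_adjop ic hdf.
have hk := L2_adjop id (L2_mulop ic hh).
rewrite /comm (adjopK id hf) => /eqP; rewrite subr_eq0 => /eqP e.
have [l hl el] := coprime_mulop ic id co hh hk e.
have hdl := L2_mulop id hl.
have eh : adjop c (mulop d f) = mulop d l.
  by rewrite -[LHS](adjopK ic hh) el adjopK.
rewrite eh; congr (mulop d _).
by rewrite -[LHS](adjopK id hl) -eh (adjopC id ic hdf) adjopK.
Qed.

End Commutation.

(** * Finite rank excludes a common variable *)

Section FiniteRank.
Variables (R : realType) (n : nat).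
Local Notation C := (Cx R).
Local Notation MI := (multiindex n).
Implicit Types (a b : MI) (x y c d g h w : MI -> C).

Definition mono (j : 'I_n) (k : nat) : MI := [ffun i => if i == j then k else 0%N].

Lemma mshift_delta b a : mshift b (delta R a) = delta R (addm a b).
Proof.
apply/funext => e; rewrite /mshift /delta.
case: ifPn => [be|nbe].
  suff -> : (subm e b == a) = (e == addm a b) by [].
  by apply/eqP/eqP => [<-|->]; rewrite ?submK ?addmK.
by case: eqP => // ee; rewrite ee lem_addl in nbe.
Qed.

(** Monomials are themselves isometric multipliers, so [mulop] and [adjop] also provide the shift
    [M], the powers of [z_j] and their adjoints. *)
Lemma isometric_delta a : isometric (delta R a).
Proof.
split=> [b|b b']; first by rewrite mshift_delta; exact: L2_delta.
rewrite !mshift_delta ip_delta /delta.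
suff -> : (addm a b' == addm a b) = (b == b') by [].
apply/eqP/eqP => [|->//] /ffunP e; apply/ffunP => i.
by have := e i; rewrite !ffunE => /addnI.
Qed.

Lemma mulop_delta a x : L2 x -> mulop (delta R a) x = mshift a x.
Proof.
move=> hx; have ia := isometric_delta a.
apply: ev_inj; [exact: L2_mulop|exact: L2_mshift|apply/funext => z].
rewrite (ev_mulop z ia hx) (ev_mshift a z hx) mulrC; congr (_ * _).
by rewrite /ev ip_deltal ?conjCK//; exact: L2_pointker.
Qed.

Lemma adjop_delta a x : adjop (delta R a) x = fun b => x (addm a b).
Proof. by apply/funext => b; rewrite adjopE mshift_delta ip_delta. Qed.

Lemma mulop_delta0 c : isometric c -> mulop c (delta R [ffun=> 0%N]) = c.
Proof. by move=> ic; rewrite /mulop Vop_delta// mshift0. Qed.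

(** Remainder and quotient by [B] recover the digits one by one. This makes the weight below
    injective on multi-indices with entries less than [B]. *)
Lemma base_expansion_inj (B m : nat) (f g : 'I_m -> nat) :
  (forall i, f i < B)%N -> (forall i, g i < B)%N ->
  (\sum_(i < m) f i * B ^ i = \sum_(i < m) g i * B ^ i)%N -> f =1 g.
Proof.
elim: m f g => [|m IH] f g fB gB; first by move=> _ [].
have split0 (h : 'I_m.+1 -> nat) : (\sum_(i < m.+1) h i * B ^ i =
    (\sum_(i < m) h (lift ord0 i) * B ^ i) * B + h ord0)%N.
  rewrite big_ord_recl expn0 muln1 addnC big_distrl /=; congr (_ + _)%N.
  by apply: eq_bigr => i _; rewrite /bump /= expnS; lia.
rewrite !split0 => e.
have B0 : (0 < B)%N by apply: leq_ltn_trans (fB ord0).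
have e0 : f ord0 = g ord0.
  by move: (congr1 (modn^~ B) e); rewrite !modnMDl !modn_small.
have e1 : (\sum_(i < m) f (lift ord0 i) * B ^ i = \sum_(i < m) g (lift ord0 i) * B ^ i)%N.
  by move: (congr1 (divn^~ B) e); rewrite !divnMDl// !divn_small ?addn0.
move=> i; have [j ->|->//] := unliftP ord0 i.
exact: (IH (fun j => f (lift ord0 j)) (fun j => g (lift ord0 j))).
Qed.

Lemma minimal_nat (P : MI -> Prop) (f : MI -> nat) : (exists a, P a) ->
  exists2 a, P a & forall b, P b -> (f a <= f b)%N.
Proof.
move=> [a Pa]; have ex : exists k, `[< exists2 b, P b & f b = k >].
  by exists (f a); apply/asboolP; exists a.
case: (ex_minnP ex) => k /asboolP[b Pb <-] hmin; exists b => // b' Pb'.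
by apply: hmin; apply/asboolP; exists b'.
Qed.

Lemma degreeD a b : degree (addm a b) = (degree a + degree b)%N.
Proof. by rewrite /degree -big_split; apply: eq_bigr => i _; rewrite ffunE. Qed.

Lemma leq_degree a i : (a i <= degree a)%N.
Proof. by rewrite /degree (bigD1 i)//= leq_addr. Qed.

Definition weight (B : nat) a : nat := (\sum_(i < n) a i * B ^ i)%N.

Lemma weightD B a b : weight B (addm a b) = (weight B a + weight B b)%N.
Proof.
by rewrite /weight -big_split; apply: eq_bigr => i _; rewrite ffunE mulnDl.
Qed.

(* The product of the lowest terms, for the order by degree and then by the base-[B] weight,
   of the [z_i]-divisible part of [d] and of [w] survives in [d w]. *)
Lemma no_cancellation d w (i : 'I_n) b : isometric d -> L2 w ->
  adjop (delta R (mono i 1)) w = 0 ->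
  adjop (delta R (mono i 1)) (mulop d w) = 0 ->
  d b != 0 -> (0 < b i)%N -> w = 0.
Proof.
move=> id hw aw adw db bi; apply/funext => a1; apply/eqP; apply: contraT => wa1.
(* [M^*] reads the coefficients one step further in [z_i], so a family that it kills has no term
   containing [z_i]. *)
have indep x a : adjop (delta R (mono i 1)) x = 0 -> (0 < a i)%N -> x a = 0.
  rewrite adjop_delta => /(congr1 (fun f => f (subm a (mono i 1)))) /= e ai.
  rewrite -[RHS]e; congr x; apply/ffunP => j; rewrite !ffunE.
  by case: eqP => [->|_]; rewrite ?add0n ?subn0// subnKC.
pose S a := d a != 0 /\ (0 < a i)%N.
have [a2 Sa2 min_a2] := @minimal_nat S (@degree n) (ex_intro _ b (conj db bi)).
have [b2 wb2 min_b2] := @minimal_nat (fun a => w a != 0) (@degree n) (ex_intro _ a1 wa1).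
(* Entries are bounded by the degree, so multi-indices of degree [degree b2] have all digits below
   [B], and equal weights force them to be equal. *)
pose B := (degree a2 + degree b2).+1.
have [a0 [Sa0 da0] min_a0] := @minimal_nat (fun a => S a /\ degree a = degree a2)
  (weight B) (ex_intro _ a2 (conj Sa2 erefl)).
have [b0 [wb0 db0] min_b0] := @minimal_nat (fun a => w a != 0 /\ degree a = degree b2)
  (weight B) (ex_intro _ b2 (conj wb2 erefl)).
have bi0 a : w a != 0 -> a i = 0%N.
  by move=> wa; apply/eqP; rewrite -leqn0 leqNgt; apply: contraNN wa => /(indep _ _ aw) ->.
have : mulop d w (addm a0 b0) = w b0 * d a0.
  apply: hassum_unique (@hassum_Vop _ _ _ _ (addm a0 b0) id hw) _.
  have -> : w b0 * d a0 = (fun e => w e * mshift e d (addm a0 b0)) b0.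
    by rewrite mshiftD.
  apply: hassum1 => e ne; apply/eqP; move: ne; apply: contraNT; rewrite /mshift.
  case: ifP => [le|_]; last by rewrite mulr0 eqxx.
  rewrite mulf_eq0 negb_or => /andP[we da].
  set a := subm _ e in da.
  have sumE : addm a e = addm a0 b0 by rewrite submK.
  have ai : (0 < a i)%N.
    have := congr1 (fun f : MI => f i) sumE; rewrite !ffunE (bi0 _ we) (bi0 _ wb0) !addn0 => ->.
    by case: Sa0.
  have degE := congr1 (@degree n) sumE; rewrite !degreeD in degE.
  have dega := min_a2 a (conj da ai); have dege := min_b2 e we.
  have ea : degree a = degree a2 by lia.
  have ee : degree e = degree b2 by lia.
  have wE := congr1 (fun f : MI => weight B f) sumE; rewrite !weightD in wE.
  have wa := min_a0 a (conj (conj da ai) ea); have we' := min_b0 e (conj we ee).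
  apply/eqP/ffunP; apply: (@base_expansion_inj B).
  - by move=> k; rewrite ltnS; apply: leq_trans (leq_degree e k) _; lia.
  - by move=> k; rewrite ltnS; apply: leq_trans (leq_degree b0 k) _; lia.
  - by rewrite -/(weight B e) -/(weight B b0); lia.
(* [addm a0 b0] contains [z_i], so its coefficient in [d w] is zero, although it was just found to
   be a product of two nonzero numbers. *)
rewrite (indep _ _ adw); last by rewrite ffunE; case: Sa0 => _; lia.
move=> /esym/eqP; rewrite mulf_eq0 (negbTE wb0) /=.
by case: Sa0 => /negbTE ->.
Qed.

(** Take a term of [g] with the least power of [z_j] and look at its exponent raised by [k] in
    [z_j]: shifts beyond [k] contribute nothing there, and those before [k] have zero coefficient by
    induction. *)
Lemma independent_shifts g (j : 'I_n) (N : nat) (p : 'I_N -> C) a :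
  g a != 0 -> \sum_(k < N) scl (p k) (mshift (mono j k) g) = 0 -> forall k, p k = 0.
Proof.
move=> ga e.
have [a0 ga0 min_a0] := @minimal_nat (fun a => g a != 0) (fun a => a j) (ex_intro _ a ga).
suff H m : forall k : 'I_N, (k < m)%N -> p k = 0 by move=> k; exact: (H k.+1).
elim: m => // m IH k; rewrite ltnS leq_eqVlt => /predU1P[km|]; last exact: IH.
have := congr1 (fun f => f (addm a0 (mono j k))) e.
rewrite fct_sumE (bigD1 k)//= /scl mshiftD big1 ?addr0.
  by move=> /eqP; rewrite mulf_eq0 (negbTE ga0) orbF => /eqP.
move=> l lk; have [lm|ml] := ltnP l m; first by rewrite IH// mul0r.
rewrite /mshift; case: ifP => [/forallP/(_ j) le|_]; last by rewrite mulr0.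
have kl : (k < l)%N by rewrite ltn_neqAle eq_sym lk -{1}km in ml *.
have [->|g0] := eqVneq (g (subm (addm a0 (mono j k)) (mono j l))) 0; first by rewrite mulr0.
have := min_a0 _ g0; move: le; rewrite !ffunE eqxx.
by lia.
Qed.

(** The matrix records one chosen expansion over the [e j] for the image of each [x k]. A
    combination annihilating it has image zero, whether or not the [e j] are independent. *)
Lemma finite_rank_constraints (T : (MI -> C) -> MI -> C)
    (S : (polydisc R n -> C) -> polydisc R n -> C)
    (m : nat) (e : 'I_m -> polydisc R n -> C) (N : nat) (x : 'I_N -> MI -> C) :
  linear_on_L2 T -> (forall f, L2 f -> S (ev f) = ev (T f)) ->
  (forall f, H2 f -> exists al : 'I_m -> C, forall z, S f z = \sum_(j < m) al j * e j z) ->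
  (forall k, L2 (x k)) ->
  exists A : 'M[C]_(N, m), forall p : 'rV[C]_N, p *m A = 0 ->
    T (\sum_(k < N) scl (p 0 k) (x k)) = 0.
Proof.
move=> lT ST hS hx; have [T1 _ _] := lT.
have /choice[al hal] : forall k, exists al : 'I_m -> C,
    forall z, S (ev (x k)) z = \sum_(j < m) al j * e j z.
  by move=> k; apply: hS; apply/H2P; exists (x k).
exists (\matrix_(k, j) al k j) => p hp.
rewrite (linear_comb _ lT hx).
have LT k : L2 (scl (p 0 k) (T (x k))) by apply: L2Z; exact: T1.
apply: ev_inj; [exact: L2_sum|exact: L2_0|apply/funext => z].
have hk := L2_pointker z.
rewrite /ev ip0l ip_suml//.
have -> : \sum_(k < N) ip (scl (p 0 k) (T (x k))) (pointker z) =
    \sum_(k < N) \sum_(j < m) p 0 k * (al k j * e j z).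
  apply: eq_bigr => k _; rewrite (ipZl _ (T1 _ (hx k)) hk) -/(ev (T (x k)) z).
  by rewrite -(ST _ (hx k)) hal big_distrr.
rewrite exchange_big big1//= => j _.
have /rowP/(_ j) := hp; rewrite !mxE => hpj.
under eq_bigr do rewrite mulrA.
rewrite -big_distrl /= (_ : \sum_(k < N) _ = 0) ?mul0r// -[RHS]hpj.
by apply: eq_bigr => k _; rewrite mxE.
Qed.

Lemma finite_rank_no_common_variable c d (i : 'I_n) a b : (1 < n)%N ->
  isometric c -> isometric d -> coprime_inner (ev c) (ev d) ->
  finite_rank (commutator (P_ (ev c)) (P_ (ev d))) ->
  c a != 0 -> (0 < a i)%N -> d b != 0 -> (0 < b i)%N -> False.
Proof.
move=> n1 ic id co [m [e [_ fr]]] ca ai db bi.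
(* Here [1 < n] enters: powers of a second variable supply the test functions. *)
have [j ji] : exists j : 'I_n, j != i.
  have [/eqP i0|i0] := eqVneq (i : nat) 0%N.
    by exists (Ordinal n1); rewrite -val_eqE /= eq_sym (eqP i0).
  by exists (Ordinal (ltnW n1)); rewrite -val_eqE /= eq_sym.
pose D : MI -> C := delta R (mono i 1).
have iD : isometric D := isometric_delta _.
have Lc := isometric_L2 ic.
pose psi := adjop D c.
have Lpsi : L2 psi by exact: L2_adjop.
(* More vectors than the [m + m] linear constraints below. *)
pose N := (m + m).+1.
pose h (k : 'I_N) := mulop (delta R (mono j k)) psi.
have ij k : isometric (delta R (mono j k)) := isometric_delta _.
have Lh k : L2 (h k) by apply: L2_mulop.
have lcd := linear_comm ic id.
have ld := linear_mulop id; have lD := linear_mulop iD.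
have SE f : L2 f -> commutator (P_ (ev c)) (P_ (ev d)) (ev f) = ev (comm c d f).
  exact: commutator_ev.
have LdH k : L2 (mulop d (h k)) by exact: L2_mulop.
have LDH k : L2 (mulop D (h k)) by exact: L2_mulop.
have LdDH k : L2 (mulop d (mulop D (h k))) by exact: L2_mulop.
have [A hA] := finite_rank_constraints lcd SE fr LdH.
have [B hB] := finite_rank_constraints lcd SE fr LdDH.
(* The joint matrix has more rows than columns, so its left kernel is nonzero. *)
have [p p0 /eqP pAB] : exists2 p : 'rV[C]_N, p != 0 & p *m row_mx A B == 0.
  have : kermx (row_mx A B) != 0.
    rewrite kermx_eq0 /row_free neq_ltn; apply/orP; left.
    by apply: leq_ltn_trans (rank_leq_col _) _.
  move=> /rowV0Pn[p /sub_kermxP hp p0]; exists p => //; exact/eqP.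
have [pA pB] : p *m A = 0 /\ p *m B = 0.
  by move: pAB; rewrite mul_mx_row -row_mx0 => /eq_row_mx[].
pose H := \sum_(k < N) scl (p 0 k) (h k).
have LH : L2 H by apply: L2_sum => k; exact: L2Z.
have cH : comm c d (mulop d H) = 0.
  by rewrite /H (linear_comb _ ld Lh); exact: hA.
have LDHH : L2 (mulop D H) := L2_mulop iD LH.
have cDH : comm c d (mulop d (mulop D H)) = 0.
  by rewrite /H (linear_comb _ lD Lh) (linear_comb _ ld LDH); exact: hB.
have e1 := coprime_commute ic id co LH cH.
have e2 := coprime_commute ic id co LDHH cDH.
pose u := adjop c (mulop D H).
have Lu : L2 u := L2_adjop ic LDHH.
have LdH' : L2 (mulop d H) := L2_mulop id LH.
have au : adjop D u = adjop c H by rewrite /u (adjopC iD ic LDHH) (adjopK iD LH).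
have LDu : L2 (adjop D u) := L2_adjop iD Lu.
(* Both sides equal [adjop c (mulop d H)]: the right one by [e1], the left one by [e2], after which
   the shift [D] meets its adjoint and cancels. *)
have e3 : adjop D (mulop d u) = mulop d (adjop D u).
  rewrite au -e1 /u -e2 (adjopC iD ic (L2_mulop id LDHH)) (mulopC id iD LH).
  by rewrite (adjopK iD LdH').
pose w := u - mulop D (adjop D u).
have LDDu : L2 (mulop D (adjop D u)) := L2_mulop iD LDu.
have Lw : L2 w := L2B Lu LDDu.
have aw : adjop D w = 0 by rewrite /w /adjop (VsB iD Lu LDDu) -!/(adjop D _) (adjopK iD LDu) subrr.
have adw : adjop D (mulop d w) = 0.
  rewrite /w /mulop (VopB id Lu LDDu) -!/(mulop _ _).
  rewrite /adjop (VsB iD (L2_mulop id Lu) (L2_mulop id LDDu)) -!/(adjop D _).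
  by rewrite e3 (mulopC id iD LDu) (adjopK iD (L2_mulop id LDu)) subrr.
have w0 : w = 0 := no_cancellation id Lw aw adw db bi.
have uE : u = mulop D (adjop D u) by apply/eqP; rewrite -subr_eq0 -/w w0.
have orth k : ip (h k) H = 0.
  (* Multiplication by [z_j^k] commutes with [M^*] since [j] differs from [i]; with [M^*] outermost,
     it can be moved to the other side of the pairing. *)
  have hE : h k = adjop D (mulop c (delta R (mono j k))).
    rewrite /h /psi -(adjop_mulop_disjoint iD (ij k) Lc); last first.
      move=> f f' l; rewrite /D /delta => /eqP; case: eqP => // -> _ /eqP; case: eqP => // -> _.
      by rewrite !ffunE; case: eqP => [->|]; [right; rewrite eq_sym (negbTE ji)|left].
    congr (adjop D _); rewrite -{1}(mulop_delta0 ic).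
    rewrite (mulopC (ij k) ic (L2_delta R _)); congr (mulop c _).
    by rewrite mulop_delta0.
  have Lk := L2_delta R (mono j k); have Lck := L2_mulop ic Lk.
  rewrite hE (ip_adjop iD Lck LH) (ipC LDHH Lck) -(ip_adjop ic LDHH Lk) -/u.
  rewrite uE (ipC Lk LDDu) -(ip_adjop iD Lk LDu) conjCK.
  (* [u] lies in the range of [M], and [z_j^k], being free of [z_i], is orthogonal to that range. *)
  have -> : adjop D (delta R (mono j k)) = 0; last by rewrite ip0l.
  rewrite adjop_delta; apply/funext => f; rewrite /delta.
  case: eqP => // /ffunP/(_ i); rewrite !ffunE eqxx eq_sym (negbTE ji).
  by lia.
have H0 : H = 0.
  have LZ k : L2 (scl (p 0 k) (h k)) := L2Z (p 0 k) (Lh k).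
  apply: (ip_eq0 LH); transitivity (\sum_(k < N) ip (scl (p 0 k) (h k)) H).
    exact: (ip_suml _ _ LZ LH).
  by apply: big1 => k _; rewrite (ipZl _ (Lh k) LH) orth mulr0.
(* Lowering [a] by one in [z_i] gives a nonzero coefficient of [psi]. The shifts of [psi] in [z_j]
   are therefore independent, and [H = 0] forces [p = 0]. *)
have psi0 : psi (subm a (mono i 1)) != 0.
  rewrite /psi adjop_delta (_ : addm _ _ = a)//.
  apply/ffunP => l; rewrite !ffunE; case: eqP => [->|]; last by rewrite add0n subn0.
  by rewrite subnKC.
have HE : \sum_(k < N) scl (p 0 k) (mshift (mono j k) psi) = 0.
  by rewrite -[RHS]H0 /H; apply: eq_bigr => k _; rewrite /h mulop_delta.
have pz := independent_shifts psi0 HE.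
by move/negP: p0; apply; apply/eqP/rowP => k; rewrite pz mxE.
Qed.

End FiniteRank.

(** * Dependence on variables read off from the coefficients *)

Section DependsOnly.
Variables (R : realType) (n : nat).
Local Notation C := (Cx R).
Local Notation MI := (multiindex n).
Implicit Types (a b : MI) (c d x : MI -> C) (I J : {set 'I_n}).

Lemma depends_only_on_ev c I : L2 c -> (forall a i, c a != 0 -> i \notin I -> a i = 0%N) ->
  depends_only_on I (ev c).
Proof.
move=> hc hI z w zw.
apply: (@hassum_unique _ _ (fun a => c a * monomial a (val z))); first exact: taylor_ev.
have hw : hassum (fun a => c a * monomial a (val w)) (ev c w) by exact: taylor_ev.
apply: eq_hassum hw => a.
have [->|ca] := eqVneq (c a) 0; first by rewrite !mul0r.
congr (_ * _); apply: eq_bigr => i _.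
have [iI|niI] := boolP (i \in I); first by rewrite zw.
by rewrite (hI a i ca niI) !expr0.
Qed.

Definition zero_coord (i : 'I_n) (z : 'rV[C]_n) : 'rV[C]_n :=
  \row_j (if j == i then 0 else z ord0 j).

Lemma zero_coord_polydisc i (z : polydisc R n) :
  [forall j, `|zero_coord i (val z) ord0 j| < 1].
Proof.
apply/forallP => j; rewrite mxE; case: eqP => _; first by rewrite normr0.
by have /forallP := valP z; apply.
Qed.

Lemma monomial_zero_coord i a (z : 'rV[C]_n) :
  monomial a (zero_coord i z) = if a i == 0%N then monomial a z else 0.
Proof.
case: eqP => [ai|/eqP ai].
  apply: eq_bigr => j _; rewrite mxE; case: eqP => [->|//].
  by rewrite ai !expr0.
by rewrite /monomial (bigD1 i)//= mxE eqxx expr0n (negbTE ai) mul0r.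
Qed.

(** Setting [z_i] to 0 leaves the function unchanged and deletes every term containing [z_i];
    uniqueness of the coefficients removes those terms from [c]. *)
Lemma taylor_depends_only_on c I : L2 c -> depends_only_on I (ev c) ->
  forall a i, c a != 0 -> i \notin I -> a i = 0%N.
Proof.
move=> hc dep a i ca niI; apply/eqP; move: ca; apply: contraNT => ai.
have ht : is_taylor (fun a => if a i == 0%N then c a else 0) (ev c).
  move=> z; pose z' : polydisc R n := 
    @exist 'rV[C]_n (fun z => [forall i, `|z ord0 i| < 1]) _ (zero_coord_polydisc i z).
  have -> : ev c z = ev c z'.
    apply: dep => j jI; rewrite /= mxE; case: eqP => // ji.
    by rewrite -ji jI in niI.
  have h : hassum (fun a => c a * monomial a (val z')) (ev c z') by exact: taylor_ev.
  apply: eq_hassum h => b; rewrite /= monomial_zero_coord.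
  by case: ifP => _; rewrite ?mulr0 ?mul0r.
have -> : c = fun a => if a i == 0%N then c a else 0.
  by apply: (@taylor_unique _ _ _ _ (ev c)) => //; exact: taylor_ev.
by rewrite (negbTE ai).
Qed.

End DependsOnly.

Theorem theorem6p2 (R : realType) (n : nat) (hn : (1 < n)%N)
    (phi1 phi2 : polydisc R n -> Cx R)
    (h1 : inner_function phi1) (h2 : inner_function phi2)
    (hco : coprime_inner phi1 phi2) :
  (finite_rank (commutator (P_ phi1) (P_ phi2)) <->
     disjoint_variables phi1 phi2) /\
  (disjoint_variables phi1 phi2 <->
     zero_operator (commutator (P_ phi1) (P_ phi2))).
Proof.
have [c ic ec] := inner_rep h1; have [d id ed] := inner_rep h2; subst phi1 phi2.
have Lc := isometric_L2 ic; have Ld := isometric_L2 id.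
have zero_finite : zero_operator (commutator (P_ (ev c)) (P_ (ev d))) ->
    finite_rank (commutator (P_ (ev c)) (P_ (ev d))).
  move=> h0; exists 0%N, (fun _ _ => 0); split=> [[]//|f /h0 hf].
  by exists (fun=> 0) => z; rewrite hf big_ord0.
have disjoint_zero : disjoint_variables (ev c) (ev d) ->
    zero_operator (commutator (P_ (ev c)) (P_ (ev d))).
  move=> [I [J [/pred0P IJ hI hJ]]] _ /H2P[x hx ->] z.
  rewrite (commutator_ev ic id hx) (comm0_disjoint ic id hx) /ev ?ip0l//.
  move=> e e' i ce de; have := IJ i; rewrite /= => /negbT; rewrite negb_and.
  move=> /orP[niI|niJ]; [left|right].
    exact: (taylor_depends_only_on Lc hI ce niI).
  exact: (taylor_depends_only_on Ld hJ de niJ).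
have finite_disjoint : finite_rank (commutator (P_ (ev c)) (P_ (ev d))) ->
    disjoint_variables (ev c) (ev d).
  move=> fr.
  (* The variables that actually occur in the expansion. A common element of the two sets is a
     variable occurring in both functions, which finite rank excludes. *)
  pose I c := [set i : 'I_n | `[< exists2 a : multiindex n, c a != 0 :> Cx R & (0 < a i)%N >]]%SET.
  have dep c' : L2 c' -> depends_only_on (I c') (ev c').
    move=> hc'; apply: depends_only_on_ev => // a i ca.
    rewrite inE => /asboolPn nex; apply/eqP; rewrite -leqn0 leqNgt; apply/negP => ai.
    by apply: nex; exists a.
  exists (I c), (I d); split; [|exact: dep|exact: dep].
  apply/pred0P => i /=; apply/negP => /andP[].
  rewrite !inE => /asboolP[a ca ai] /asboolP[b db bi].
  exact: (finite_rank_no_common_variable hn ic id hco fr ca ai db bi).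
by split; split=> // h; [exact/zero_finite/disjoint_zero|exact/finite_disjoint/zero_finite].
Qed.
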